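(* Let $\eta>0$, $\alpha\in(1/2,1)$, $\eta_i=\eta i^{-\alpha}$, let $e_i\overset{\mathrm{i.i.d.}}{\sim}\mathcal N(0,\sigma_e^2)$, and let $X_0=0$, $X_i=(1-\eta_i)X_{i-1}+\eta_ie_i$ for $i\ge1$. Let $\ell_i=\lfloor Ci^{\alpha}\log i\rfloor$ with $\eta C>1$, $t_i=i-\ell_i+1$, $W_i=\sum_{j=t_i}^{i-1}X_j$, and $$\widehat\sigma_n=\frac1n\sum_{i=1}^n\big[X_i^2+2X_iW_i\big],\qquad \sigma_n=\mathrm{Var}(\sqrt n\,\bar X_n)=\frac1n\mathbb{E}\Big|\sum_{i=1}^nX_i\Big|^2.$$ Then $\mathbb{E}[(\widehat\sigma_n-\sigma_n)^2]\asymp n^{-1+\alpha}\log n$.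
   Context: $\bar X_n=n^{-1}\sum_{i=1}^nX_i$. $a_n\asymp b_n$ means $c b_n\le a_n\le C' b_n$ for constants $0<c\le C'$ independent of $n$. *)

(* Defs.v *)
From HB Require Import structures.
From mathcomp Require Import all_boot all_order all_algebra.
From mathcomp Require Import all_classical all_reals all_analysis.
Set Implicit Arguments. Unset Strict Implicit. Unset Printing Implicit Defensive.
Import Order.TTheory GRing.Theory Num.Theory.
Import numFieldNormedType.Exports.
Local Open Scope classical_set_scope.
Local Open Scope ring_scope.

Definition mutually_independent {d} {T : measurableType d} {R : realType}
    (P : probability T R) (D : set nat) (X : nat -> {RV P >-> R}) : Prop :=
  forall (I : seq nat) (A : nat -> set R),
    uniq I -> {subset I <= D} -> (forall i, measurable (A i)) ->
    P (\big[setI/setT]_(i <- I) (X i @^-1` A i)) =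
    (\prod_(i <- I) P (X i @^-1` A i))%E.

Definition step {R : realType} (eta alpha : R) (i : nat) : R :=
  eta * (i%:R `^ (- alpha)).

Fixpoint Xseq {T : Type} {R : realType} (eta alpha : R) (e : nat -> T -> R)
    (i : nat) : T -> R :=
  match i with
  | 0 => fun _ => 0
  | i'.+1 => fun w => (1 - step eta alpha i'.+1) * Xseq eta alpha e i' w
                      + step eta alpha i'.+1 * e i'.+1 w
  end.

(* l_i = floor (C i^alpha log i) (argument is >= 0) *)
Definition ell {R : realType} (C alpha : R) (i : nat) : nat :=
  Num.truncn (C * (i%:R `^ alpha) * ln (i%:R)).

(* W_i = sum_{j = t_i}^{i-1} X_j with t_i = i - l_i + 1
   (indices j <= 0 contribute X_j = 0) *)
Definition Wsum {T : Type} {R : realType} (eta alpha C : R) (e : nat -> T -> R)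
    (i : nat) (w : T) : R :=
  \sum_((i.+1 - ell C alpha i)%N <= j < i) Xseq eta alpha e j w.

Definition sigma_hat {T : Type} {R : realType} (eta alpha C : R)
    (e : nat -> T -> R) (n : nat) (w : T) : R :=
  n%:R^-1 * \sum_(1 <= i < n.+1)
     (Xseq eta alpha e i w ^+ 2
      + 2 * Xseq eta alpha e i w * Wsum eta alpha C e i w).

Definition sigma_n {d} {T : measurableType d} {R : realType}
    (P : probability T R) (eta alpha : R) (e : nat -> T -> R) (n : nat) : R :=
  n%:R^-1 * fine ('E_P[fun w => ((\sum_(1 <= i < n.+1) Xseq eta alpha e i w) ^+ 2)%R])%E.
Arguments mutually_independent {d T R} P D X.

(* Main.v *)
Require Import Defs.
From HB Require Import structures.
From mathcomp Require Import all_boot all_order all_algebra.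
From mathcomp Require Import all_classical all_reals all_analysis.
From mathcomp Require Import measurable_realfun ring lra zify.
Set Implicit Arguments.
Unset Strict Implicit.
Unset Printing Implicit Defensive.
Import Order.TTheory GRing.Theory Num.Theory.
Local Open Scope classical_set_scope.
Local Open Scope ring_scope.

(** [X_i] is a linear combination [sum_p coef p i * e_p], so [n * sigma_hat_n] is a quadratic
    form [sum_{p,q} A_pq e_p e_q] in independent centred variables, and its mean square error
    is computed exactly from the moments of order at most 4: it is the squared bias plus, up
    to constants, the sum of the [(A_pq + A_qp)^2].  Upper bound: the rows and the columns of
    [coef] are absolutely summable, so a Schur test bounds the Frobenius norm of [A] by the
    total window length [sum_i ell_i], of order [n^(1 + alpha) log n].  Lower bound: [A_pq] is
    bounded below for [p] close to [n] and [q] in the window of [p], which is about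
    [n * n^alpha log n] pairs.  The bias at time [i] is damped by the product of the
    [1 - eta_m] over the window, of order [1 / i] because [eta * C > 1], so that the squared
    bias is only [O((log n)^2)].  Gaussianity matters only through mean zero, positive
    variance and a finite fourth moment. *)

(** * Means and independence *)

(** When [eta] is large the first steps exceed 1 and [1 - eta_m] is negative. Past a rank [N0] these
    factors lie between 0 and 1; upper bounds are taken in absolute value, and the lower bound keeps
    only pairs beyond that rank, where all entries are nonnegative and nothing cancels. Row sums of
    [coef] stay bounded although the decay is not geometric: [1 / eta_m] grows by a vanishing amount
    per step because [alpha < 1], so [|coef p m| / eta_m] is a potential that loses a fixed share of
    [|coef p m|] at each step. The window length enters the Frobenius bound only once: the weights
    of [X_i + 2 W_i] have a sum of order [ell_i], but each of them is bounded, so the sum of their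
    squares is of order [ell_i] as well. In the lower bound a weight born with size [eta_p] survives
    for about [1 / eta_p] steps; summing over that many [i] and that many [j] makes [A_pq] of order
    1. The fourth cumulant of a general law may be negative; the Jensen bound on the fourth moment
    is exactly what lets the diagonal of [A] absorb it. *)

Import HBNNSimple.

(** Change of variables for the image under [X] of the measure with density [G], from indicators to
    simple functions to monotone limits. It is used twice: with [G] the product of the other factors
    it integrates out one independent variable, and with [X] the identity and [G] the normal density
    it passes to Lebesgue measure. *)
Lemma ge0_integral_density {d d'} {T : measurableType d} {T' : measurableType d'}
    {R : realType} (mu : {measure set T -> \bar R}) (Q : {measure set T' -> \bar R})
    (X : T -> T') (G : T -> R) :
  measurable_fun setT X -> measurable_fun setT G -> (forall w, 0 <= G w) ->
  (forall A, measurable A -> Q A = \int[mu]_w (\1_A (X w) * G w)%:E)%E ->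
  forall f : T' -> R, measurable_fun setT f -> (forall y, 0 <= f y) ->
  (\int[Q]_y (f y)%:E = \int[mu]_w (f (X w) * G w)%:E)%E.
Proof.
move=> mX mG G0 QE f mf f0.
have mfX (h : T' -> R) : measurable_fun setT h ->
    measurable_fun setT (fun w => (h (X w) * G w)%:E).
  move=> mh; apply/measurable_EFinP/measurable_funM => //.
  exact: (measurableT_comp mh).
have indE A : measurable A ->
    (\int[Q]_y (\1_A y)%:E = \int[mu]_w (\1_A (X w) * G w)%:E)%E.
  by move=> mA; rewrite integral_indic// setIT QE.
have simpleE (h : {nnsfun T' >-> R}) :
    (\int[Q]_y (h y)%:E = \int[mu]_w (h (X w) * G w)%:E)%E.
  under [LHS]eq_integral do rewrite fimfunE -fsumEFin//.
  rewrite [LHS]ge0_integral_fsum//; last 2 first.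
    - by move=> r; exact/measurable_EFinP/measurableT_comp.
    - by move=> n x _; rewrite EFinM nnfun_muleindic_ge0.
  under [RHS]eq_integral => w _.
    rewrite EFinM fimfunE -fsumEFin// ge0_mule_fsuml; last first.
      by move=> r; rewrite EFinM nnfun_muleindic_ge0.
    under eq_fsbigr => r _ do rewrite -EFinM.
    over.
  rewrite [RHS]ge0_integral_fsum//; last 2 first.
    - move=> r; apply: (mfX (fun y => r * \1_(h @^-1` [set r]) y)).
      by apply: measurable_funM => //; exact: measurable_indic.
    - move=> r w _; rewrite EFinM mule_ge0 ?lee_fin//.
      by rewrite -lee_fin EFinM nnfun_muleindic_ge0.
  apply: eq_fsbigr => r _.
  have [r0|r0] := ltP r 0.
    rewrite !integral0_eq//= => w _; rewrite preimage_nnfun0//.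
      by rewrite indic0 mulr0 mul0r.
    by rewrite indic0 mulr0.
  rewrite integralZl_indic_nnsfun// indE// -ge0_integralZl_EFin//.
  - by apply: eq_integral => w _; rewrite -EFinM mulrA.
  - by move=> w _; rewrite lee_fin mulr_ge0.
  - by apply: mfX; exact: measurable_indic.
have mEf : measurable_fun setT (EFin \o f) by exact/measurable_EFinP.
pose f_ := nnsfun_approx measurableT mEf.
transitivity (lim (\int[Q]_x (f_ n x)%:E @[n --> \oo])%E).
  rewrite -monotone_convergence//=.
  - apply: eq_integral => ? _; apply/esym/cvg_lim => //=.
    by apply: cvg_nnsfun_approx => // x _; rewrite lee_fin.
  - by move=> n; exact/measurable_EFinP/measurable_funTS.
  - by move=> n ? _; rewrite lee_fin.
  - by move=> ? _ ? ? mn; rewrite lee_fin; exact/lefP/nd_nnsfun_approx.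
rewrite (_ : (\int[mu]_w _)%E =
    lim (\int[mu]_w (f_ n (X w) * G w)%:E @[n --> \oo])%E); last first.
  rewrite -monotone_convergence//=.
  - apply: eq_integral => w _; apply/esym/cvg_lim => //=.
    under eq_fun do rewrite EFinM.
    rewrite EFinM; apply: cvgeZr => //.
    by apply: cvg_nnsfun_approx => // x _; rewrite lee_fin.
  - by move=> n; exact: mfX.
  - by move=> n ? _; rewrite lee_fin mulr_ge0.
  - move=> ? _ ? ? mn; rewrite lee_fin ler_wpM2r//.
    exact/lefP/nd_nnsfun_approx.
by apply: congr_lim; apply/funext => n; exact: simpleE.
Qed.

(** Integrability and a real value are bundled so that linearity holds without side conditions and
    moment computations stay in [R]. *)
Definition has_mean {d} {T : measurableType d} {R : realType}
    (P : {measure set T -> \bar R}) (f : T -> R) (m : R) :=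
  P.-integrable setT (EFin \o f) /\ (\int[P]_w (f w)%:E = m%:E)%E.

Section has_mean_theory.
Context {d} {T : measurableType d} {R : realType}.
Implicit Types (P : {measure set T -> \bar R}) (f g : T -> R) (m n : R).

Lemma eq_has_mean P f g m n : f =1 g -> m = n -> has_mean P f m -> has_mean P g n.
Proof. by move=> /funext -> ->. Qed.

Lemma has_meanD P f g m n : has_mean P f m -> has_mean P g n ->
  has_mean P (fun w => f w + g w) (m + n).
Proof.
move=> [fi fm] [gi gn]; split; first exact: (integrableD measurableT fi gi).
by rewrite EFinD -fm -gn -integralD_EFin.
Qed.

Lemma has_meanZ P f m k : has_mean P f m ->
  has_mean P (fun w => k * f w) (k * m).
Proof.
move=> [fi fm]; split; first exact: (integrableZl measurableT k fi).
by rewrite EFinM -fm -integralZl.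
Qed.

Lemma has_mean0 P : has_mean P (cst 0) 0.
Proof. by split; [exact: integrable0 | exact: integral0]. Qed.

Lemma has_mean_sum (I : eqType) (s : seq I) P (f : I -> T -> R) (m : I -> R) :
  (forall i, i \in s -> has_mean P (f i) (m i)) ->
  has_mean P (fun w => \sum_(i <- s) f i w) (\sum_(i <- s) m i).
Proof.
elim: s => [|i s ih] fm.
  by apply: (eq_has_mean _ _ (has_mean0 P)) => [w|]; rewrite big_nil.
have fms j : j \in s -> has_mean P (f j) (m j).
  by move=> js; apply: fm; rewrite inE js orbT.
by apply: (eq_has_mean _ _ (has_meanD (fm i (mem_head _ _)) (ih fms))) => [w|];
  rewrite big_cons.
Qed.

Lemma has_meanB P f g m n : has_mean P f m -> has_mean P g n ->
  has_mean P (fun w => f w - g w) (m - n).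
Proof.
move=> fm gn; apply: (eq_has_mean _ _ (has_meanD fm (has_meanZ (-1) gn))) => [w|];
by rewrite mulN1r.
Qed.

Lemma has_mean_ge0 P f m : (forall w, 0 <= f w) -> has_mean P f m -> 0 <= m.
Proof.
by move=> f0 [_ fm]; rewrite -lee_fin -fm integral_ge0// => w _; rewrite lee_fin.
Qed.

Lemma ge0_has_mean P f m : measurable_fun setT f -> (forall w, 0 <= f w) ->
  (\int[P]_w (f w)%:E = m%:E)%E -> has_mean P f m.
Proof.
move=> mf f0 fm; split=> //; apply/integrableP; split; first exact/measurable_EFinP.
under eq_integral do rewrite /= ger0_norm//.
by rewrite fm ltry.
Qed.

Lemma has_mean_measurable P f m : has_mean P f m -> measurable_fun setT f.
Proof. by move=> [/measurable_int/measurable_EFinP]. Qed.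

Lemma has_mean_le P f g m : measurable_fun setT f ->
  (forall w, `|f w| <= g w) -> has_mean P g m -> exists n, has_mean P f n.
Proof.
move=> mf fg [gi _].
have fi : P.-integrable setT (EFin \o f).
  apply: le_integrable gi => //; first exact/measurable_EFinP.
  by move=> w _; rewrite /= lee_fin (le_trans (fg w))// ler_norm.
exists (fine (\int[P]_w (f w)%:E)%E); split=> //.
by rewrite fineK// (integrable_fin_num measurableT fi).
Qed.

Lemma has_mean_cst (P : probability T R) k : has_mean P (cst k) k.
Proof.
split; last by rewrite /= integral_cst//= probability_setT mule1.
exact: finite_measure_integrable_cst.
Qed.

End has_mean_theory.

Lemma expectation_has_mean {d} {T : measurableType d} {R : realType}
    (P : probability T R) (f : T -> R) (m : R) :
  has_mean P f m -> 'E_P[f]%E = m%:E.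
Proof. by move=> [_ <-]; rewrite unlock. Qed.

Section independence.
Context {d} {T : measurableType d} {R : realType} (P : probability T R).
Variables (D : set nat) (X : nat -> {RV P >-> R}).
Hypothesis indX : mutually_independent P D X.

Lemma indep_indic (I : seq nat) (A : nat -> set R) :
  uniq I -> {subset I <= D} -> (forall i, measurable (A i)) ->
  has_mean P (fun w => \prod_(i <- I) \1_(A i) (X i w))
    (\prod_(i <- I) fine (P (X i @^-1` A i))).
Proof.
move=> uI ID mA.
have mXA i : measurable (X i @^-1` A i).
  by rewrite -[X in measurable X]setTI; exact: measurable_funP.
have -> : (fun w => \prod_(i <- I) \1_(A i) (X i w)) =
    \1_(\big[setI/setT]_(i <- I) (X i @^-1` A i)) :> (T -> R).
  apply/funext => w; elim: I {uI ID} => [|i I ih].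
    by rewrite !big_nil indicT.
  by rewrite !big_cons ih indicI.
have mI : measurable (\big[setI/setT]_(i <- I) (X i @^-1` A i)).
  by apply: bigsetI_measurable.
apply: ge0_has_mean; [exact: measurable_indic|by []|].
rewrite integral_indic// setIT; apply: (etrans (indX uI ID mA)).
elim: I {uI ID mI} => [|i I ih]; first by rewrite !big_nil.
by rewrite !big_cons EFinM ih fineK// fin_num_measure.
Qed.

(** Independence is only given for events, so indicators are traded for functions one factor at a
    time: [I2] holds the factors that are still indicators. To treat [i], the induction hypothesis
    is applied with [i] temporarily in [I2], for every indicator. *)
Lemma indep_has_mean_prod_ge0 (I1 I2 : seq nat) (f : nat -> R -> R) (m : nat -> R) :
  uniq (I1 ++ I2) -> {subset I1 ++ I2 <= D} ->
  (forall i, i \in I1 -> [/\ measurable_fun setT (f i), (forall x, 0 <= f i x)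
                           & has_mean P (f i \o X i) (m i)]) ->
  (forall i, i \in I2 -> exists A, [/\ measurable A, f i = \1_A
                                     & m i = fine (P (X i @^-1` A))]) ->
  has_mean P (fun w => \prod_(i <- I1 ++ I2) f i (X i w)) (\prod_(i <- I1 ++ I2) m i).
Proof.
elim: I1 I2 f m => [|i I1 ih] I2 f m /=.
  move=> uI ID _ fI2.
  (* [indep_indic] wants a measurable set at every index; off [I2] it is [setT]. *)
  have /choice[A hA] i : exists A, measurable A /\
      (i \in I2 -> f i = \1_A /\ m i = fine (P (X i @^-1` A))).
    have [/fI2[A [mA fA mi]]|_] := boolP (i \in I2); first by exists A.
    by exists setT.
  apply: (eq_has_mean _ _ (indep_indic uI ID (fun i => (hA i).1))) => [w|].
    by apply: eq_big_seq => i /(hA i).2[-> _].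
  by apply: eq_big_seq => i /(hA i).2[_ ->].
move=> /andP[iI uI] iID f1 f2.
have ID : {subset I1 ++ I2 <= D} by move=> j jI; apply: iID; rewrite inE jI orbT.
have [mfi fi0 fimi] := f1 i (mem_head _ _).
have f1' j : j \in I1 -> [/\ measurable_fun setT (f j), (forall x, 0 <= f j x)
                           & has_mean P (f j \o X j) (m j)].
  by move=> jI; apply: f1; rewrite inE jI orbT.
have HG := ih I2 f m uI ID f1' f2.
set G := (fun w : T => _) in HG; set g := \prod_(_ <- _) _ in HG.
have G0 w : 0 <= G w.
  rewrite /G big_seq_cond prodr_ge0// => j /andP[+ _].
  rewrite mem_cat => /orP[/f1'[]//|/f2[A [_ -> _]]].
  by [].
have g0 := has_mean_ge0 G0 HG.
(* The law of [X i] scaled by the mean of the other factors; [QE] identifies it with the image of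
   the measure of density [G]. *)
pose Q := mscale (NngNum g0) (distribution P (X i)).
have mG := has_mean_measurable HG.
have QE A : measurable A -> Q A = (\int[P]_w (\1_A (X i w) * G w)%:E)%E.
  move=> mA.
  have perm_iI : perm_eq (I1 ++ i :: I2) (i :: I1 ++ I2)
    by rewrite -[i :: I2]cat1s -[i :: _ ++ _]cat1s perm_catCA.
  have [] := ih (i :: I2) (fun j => if j == i then \1_A else f j)
    (fun j => if j == i then fine (P (X i @^-1` A)) else m j).
  - by rewrite (perm_uniq perm_iI) /= iI.
  - by move=> j; rewrite (perm_mem perm_iI); exact: iID.
  - move=> j jI; have [ji|_] := eqVneq j i; last exact: f1'.
    by move: iI; rewrite -ji mem_cat jI.
  - move=> j; rewrite inE; have [-> _|_ /= /f2//] := eqVneq j i.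
    by exists A.
  move=> _; rewrite (perm_big _ perm_iI) big_cons eqxx.
  rewrite (_ : \prod_(j <- I1 ++ I2) _ = g) => [|]; last first.
    apply: eq_big_seq => j jI; case: eqP => // ji.
    by move: iI; rewrite -ji jI.
  have -> : (fun w => (\prod_(j <- I1 ++ i :: I2)
      (if j == i then \1_A else f j) (X j w))%:E) =
      (fun w => (\1_A (X i w) * G w)%:E).
    apply/funext => w; congr EFin; rewrite (perm_big _ perm_iI) big_cons eqxx.
    congr (_ * _); apply: eq_big_seq => j jI; case: eqP => // ji.
    by move: iI; rewrite -ji jI.
  move=> ->; rewrite /Q /mscale/= /distribution /pushforward EFinM muleC fineK//.
  rewrite fin_num_measure//.
  by rewrite -[X in measurable X]setTI; exact: measurable_funP.
have mXi : measurable_fun setT (X i) by exact: measurable_funP.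
apply: (eq_has_mean (f := fun w => f i (X i w) * G w) (m := m i * g)).
- by move=> w; rewrite big_cons.
- by rewrite big_cons.
apply: ge0_has_mean.
- by apply: measurable_funM => //; exact: (measurableT_comp mfi).
- by move=> w; rewrite mulr_ge0.
rewrite -(ge0_integral_density mXi mG G0 QE mfi fi0).
rewrite ge0_integral_mscale//=; last 2 first.
- exact/measurable_EFinP.
- by move=> ? _; rewrite lee_fin.
rewrite ge0_integral_distribution//; last exact/measurable_EFinP.
case: fimi => _ /= ->.
by rewrite -EFinM mulrC.
Qed.

(** Here [I2] collects the factors known to be nonnegative. The next factor is split into positive
    and negative parts, each of which joins [I2]; both have a mean because [|f i|] dominates
    them. *)
Lemma indep_has_mean_prod_signed (I1 I2 : seq nat) (f : nat -> R -> R) (m : nat -> R) :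
  uniq (I1 ++ I2) -> {subset I1 ++ I2 <= D} ->
  (forall i, i \in I1 ++ I2 -> measurable_fun setT (f i) /\
                               has_mean P (f i \o X i) (m i)) ->
  (forall i, i \in I2 -> forall x, 0 <= f i x) ->
  has_mean P (fun w => \prod_(i <- I1 ++ I2) f i (X i w)) (\prod_(i <- I1 ++ I2) m i).
Proof.
elim: I1 I2 f m => [|i I1 ih] I2 f m /=.
  move=> uI ID f12 f2; rewrite -{1 2}(cats0 I2).
  apply: indep_has_mean_prod_ge0; rewrite ?cats0//.
  by move=> i iI; have [? ?] := f12 i iI; split=> //; exact: f2.
move=> /andP[iI uI] iID f12 f2.
have perm_iI : perm_eq (I1 ++ i :: I2) (i :: I1 ++ I2)
    by rewrite -[i :: I2]cat1s -[i :: _ ++ _]cat1s perm_catCA.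
have [mfi fimi] := f12 i (mem_head _ _).
have half (h : R -> R) k : measurable_fun setT h -> (forall x, 0 <= h x) ->
    has_mean P (h \o X i) k ->
    has_mean P (fun w => h (X i w) * \prod_(j <- I1 ++ I2) f j (X j w))
      (k * \prod_(j <- I1 ++ I2) m j).
  move=> mh h0 hk.
  have /(_ _ _ _ _) := ih (i :: I2) (fun j => if j == i then h else f j)
    (fun j => if j == i then k else m j).
  rewrite (perm_uniq perm_iI) /= iI uI => /(_ isT) H.
  apply: (eq_has_mean _ _ (H _ _ _)).
  - move=> w; rewrite (perm_big _ perm_iI) big_cons eqxx.
    congr (_ * _); apply: eq_big_seq => j jI; case: eqP => // ji.
    by move: iI; rewrite -ji jI.
  - rewrite (perm_big _ perm_iI) big_cons eqxx.
    congr (_ * _); apply: eq_big_seq => j jI; case: eqP => // ji.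
    by move: iI; rewrite -ji jI.
  - by move=> j; rewrite (perm_mem perm_iI); exact: iID.
  - move=> j; rewrite (perm_mem perm_iI) => jI; case: eqP => [->//|_].
    exact: f12.
  - by move=> j; rewrite inE; case: eqP => [//|_ /= /f2].
have mpos : measurable_fun setT (fun x => Num.max (f i x) 0).
  exact: measurable_maxr.
have mneg : measurable_fun setT (fun x => Num.max (- f i x) 0).
  by apply: measurable_maxr => //; exact: measurableT_comp.
have mXi : measurable_fun setT (X i) by exact: measurable_funP.
have mabs : has_mean P (fun w => `|f i (X i w)|) (fine (\int[P]_w `|f i (X i w)|%:E)%E).
  have iabs : P.-integrable setT (EFin \o (fun w => `|f i (X i w)|)).
    by case: fimi => /integrable_abse.
  by split=> //; rewrite fineK// (integrable_fin_num measurableT iabs).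
have le_max_norm (a : R) : `|Num.max a 0| <= `|a|.
  by rewrite ger0_norm ?le_max ?lexx ?orbT// ge_max ler_norm normr_ge0.
have [p Hp] := has_mean_le (measurableT_comp mpos mXi)
  (fun w => le_max_norm (f i (X i w))) mabs.
have [n Hn] : exists n, has_mean P (fun w => Num.max (- f i (X i w)) 0) n.
  apply: (has_mean_le (measurableT_comp mneg mXi) _ mabs) => w.
  by rewrite -[X in _ <= X]normrN; exact: le_max_norm.
have pnE x : f i x = Num.max (f i x) 0 - Num.max (- f i x) 0.
  by case: (ltP (f i x) 0) => h; case: (ltP (- f i x) 0) => h'; lra.
have mE : m i = p - n.
  have [_ Hpn] := has_meanB Hp Hn; case: fimi => _.
  rewrite (_ : (\int[P]_w _)%E = (p - n)%:E) => [[]//|].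
  by rewrite -Hpn; apply: eq_integral => w _; rewrite /= {1}pnE.
have max0 (a : R) : 0 <= Num.max a 0 by rewrite le_max lexx orbT.
apply: (eq_has_mean _ _ (has_meanB (half _ _ mpos (fun=> max0 _) Hp)
  (half _ _ mneg (fun=> max0 _) Hn))) => [w|].
- by rewrite big_cons -mulrBl -pnE.
- by rewrite big_cons -mulrBl -mE.
Qed.

Lemma indep_has_mean_prod (I : seq nat) (f : nat -> R -> R) (m : nat -> R) :
  uniq I -> {subset I <= D} ->
  (forall i, i \in I -> measurable_fun setT (f i) /\ has_mean P (f i \o X i) (m i)) ->
  has_mean P (fun w => \prod_(i <- I) f i (X i w)) (\prod_(i <- I) m i).
Proof.
move=> uI ID fm; rewrite -{1 2}(cats0 I).
by apply: indep_has_mean_prod_signed; rewrite ?cats0.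
Qed.

(** Grouping equal indices turns a word in the variables into powers of distinct ones, to which
    independence applies. Words of length 2 and 4 are what quadratic forms require. *)
Lemma indep_has_mean_monomial (M : nat -> R) (s : seq nat) :
  {subset s <= D} ->
  (forall i k, i \in s -> (k <= size s)%N -> has_mean P (fun w => X i w ^+ k) (M k)) ->
  has_mean P (fun w => \prod_(i <- s) X i w)
    (\prod_(i <- undup s) M (count_mem i s)).
Proof.
move=> sD XM.
have := @indep_has_mean_prod (undup s) (fun i x => x ^+ count_mem i s)
  (fun i => M (count_mem i s)) (undup_uniq s).
move=> H; apply: (eq_has_mean _ _ (H _ _)) => [w|||].
- by rewrite -[RHS]big_undup_iterop_count; apply: eq_bigr => i _.
- by [].
- by move=> i; rewrite mem_undup; exact: sD.
- move=> i; rewrite mem_undup => si; split; first exact: measurable_funX.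
  by apply: XM => //; exact: count_size.
Qed.

End independence.

(** * Gaussian moments *)

Section gaussian_moments.
Context {R : realType} (s : R).
Hypothesis s_gt0 : 0 < s.
Local Notation N := (normal_prob 0 s).
Local Notation mu := lebesgue_measure.

Let s_neq0 : s != 0. Proof. by rewrite gt_eqF. Qed.

Lemma ge0_integral_normal_prob (f : R -> R) :
  measurable_fun setT f -> (forall x, 0 <= f x) ->
  (\int[N]_x (f x)%:E = \int[mu]_x (f x * normal_pdf 0 s x)%:E)%E.
Proof.
move=> mf f0.
apply: (@ge0_integral_density _ _ _ _ _ mu N (@idfun R)) => //.
- exact: measurable_id.
- exact: measurable_normal_pdf.
- exact: normal_pdf_ge0.
move=> A mA; rewrite /normal_prob [LHS]integral_mkcond; apply: eq_integral => x _.
by rewrite patchE indicE /=; case: (x \in A); rewrite ?mul1r ?mul0r.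
Qed.

Lemma ge0_lebesgue_integralN (g : R -> R) :
  measurable_fun setT g -> (forall x, 0 <= g x) ->
  (\int[mu]_x (g x)%:E = \int[mu]_x (g (- x))%:E)%E.
Proof.
move=> mg g0.
rewrite -[in RHS](preimage_setT (-%R : _ -> measurableTypeR R)).
rewrite -(@ge0_integral_pushforward _ _ _ (measurableTypeR R) _ _ _ _ _ (EFin \o g))//=.
- by apply: eq_measure_integral => //= A mA _; exact/esym/lebesgue_measureN.
- exact/measurable_EFinP.
- by move=> y _; rewrite lee_fin.
Qed.

(* [x ^ 4] is absorbed by doubling the standard deviation, since [y ^ 2 <= 4 exp y]. *)
Let pow4_pdf_le : exists2 K : R, 0 <= K &
  forall x, x ^+ 4 * normal_pdf 0 s x <= K * normal_pdf 0 (2 * s) x.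
Proof.
have s2_neq0 : 2 * s != 0 by rewrite mulf_neq0.
(* [1 / c] is [1 / (2 s^2) - 1 / (8 s^2)], so that [expR (x ^+ 2 / c)] is the ratio of the two
   Gaussian exponentials. *)
pose c : R := 8 / 3 * s ^+ 2.
have c_gt0 : 0 < c by rewrite mulr_gt0// exprn_gt0.
have peak0 := normal_peak_gt0 s2_neq0.
exists (4 * c ^+ 2 * normal_peak s / normal_peak (2 * s)).
  apply: divr_ge0; last exact: normal_peak_ge0.
  apply: mulr_ge0; last exact: normal_peak_ge0.
  by apply: mulr_ge0; rewrite ?sqr_ge0.
move=> x; rewrite !normal_pdfE// [leRHS]mulrA divfK ?gt_eqF//.
rewrite /normal_fun !subr0.
set y := x ^+ 2 / c.
have y0 : 0 <= y by rewrite divr_ge0 ?sqr_ge0 ?ltW.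
have yexp : y ^+ 2 <= 4 * expR y.
  have -> : expR y = expR (y / 2) ^+ 2.
    by rewrite expr2 -expRD -splitr.
  have h1 : 1 + y / 2 <= expR (y / 2) by exact: expR_ge1Dx.
  have h0 : 0 <= y / 2 by rewrite divr_ge0.
  have : (y / 2) ^+ 2 <= expR (y / 2) ^+ 2.
    by rewrite lerXn2r ?nnegrE ?expR_ge0//; lra.
  by move: (expR (y / 2) ^+ 2) => e; rewrite expr_div_n; lra.
have x4 : x ^+ 4 = c ^+ 2 * y ^+ 2.
  by rewrite /y; field; rewrite gt_eqF.
have -> : expR (- x ^+ 2 / ((2 * s) ^+ 2 *+ 2)) =
    expR y * expR (- x ^+ 2 / (s ^+ 2 *+ 2)).
  rewrite -expRD; congr expR; rewrite /y /c -[s ^+ 2 *+ 2]mulr_natl -[_ *+ 2]mulr_natl; field.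
  by rewrite s_neq0.
rewrite x4.
have := expR_ge0 (- x ^+ 2 / (s ^+ 2 *+ 2)).
have := normal_peak_ge0 s.
have := sqr_ge0 c.
move: (expR _) (expR _) (normal_peak s) (c ^+ 2) yexp => E ey pk c2 yexp c20 pk0 E0.
have -> : c2 * y ^+ 2 * (pk * E) = y ^+ 2 * (c2 * pk * E) by ring.
have -> : 4 * c2 * pk * (ey * E) = 4 * ey * (c2 * pk * E) by ring.
by rewrite ler_wpM2r// !mulr_ge0.
Qed.

Lemma normal_prob_pow4 : exists m, has_mean N (fun x : R => x ^+ 4) m.
Proof.
have [K K0 leK] := pow4_pdf_le.
have x40 (x : R) : 0 <= x ^+ 4 by rewrite exprn_even_ge0.
have mx4 : measurable_fun setT (fun x : R => x ^+ 4) by exact: measurable_funX.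
have mN0 : (0 <= \int[N]_x (x ^+ 4)%:E)%E by apply: integral_ge0 => x _; rewrite lee_fin.
exists (fine (\int[N]_x (x ^+ 4)%:E)%E); apply: ge0_has_mean => //.
rewrite fineK// ge0_fin_numE// ge0_integral_normal_prob//.
apply: (@le_lt_trans _ _ (\int[mu]_x (K%:E * (normal_pdf 0 (2 * s) x)%:E))%E).
  apply: ge0_le_integral => //.
  - by move=> x _; rewrite lee_fin mulr_ge0 ?normal_pdf_ge0.
  - apply/measurable_EFinP/measurable_funM => //; exact: measurable_normal_pdf.
  - apply/measurable_funeM/measurable_EFinP; exact: measurable_normal_pdf.
  - by move=> x _; rewrite -EFinM lee_fin.
by rewrite integralZl//= ?integral_normal_pdf ?mule1 ?ltry//; exact: integrable_normal_pdf.
Qed.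

Lemma normal_prob_pow k : (k <= 4)%N -> exists m, has_mean N (fun x : R => x ^+ k) m.
Proof.
move=> k4; have [m4 H4] := normal_prob_pow4.
apply: has_mean_le (has_meanD (has_mean_cst N 1) H4); first exact: measurable_funX.
move=> x; rewrite normrX /=.
have -> : x ^+ 4 = `|x| ^+ 4 by rewrite -normrX ger0_norm// exprn_even_ge0.
have [x1|x1] := leP `|x| 1.
  by rewrite (le_trans (exprn_ile1 _ _ _))// lerDl exprn_ge0.
by rewrite (le_trans (ler_weXn2l (ltW x1) k4))// lerDr.
Qed.

(** The density is even, so the reflection of Lebesgue measure gives the positive and negative parts
    of [x] the same integral. *)
Lemma normal_prob_mean : has_mean N (@idfun R) 0.
Proof.
have [m1 H1] := @normal_prob_pow 1 isT.
have mmax (h : R -> R) : measurable_fun setT h ->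
    measurable_fun setT (fun x => Num.max (h x) 0).
  by move=> mh; exact: measurable_maxr.
have max0 (a : R) : 0 <= Num.max a 0 by rewrite le_max lexx orbT.
have Habs : exists m, has_mean N (fun x : R => `|x|) m.
  case: H1 => /integrable_abse H1 _.
  exists (fine (\int[N]_x (`|x|)%:E)%E); split; first exact: H1.
  by rewrite fineK//; exact: (integrable_fin_num measurableT H1).
have {Habs} [a Ha] := Habs.
have le_max_norm (x : R) : `|Num.max x 0| <= `|x|.
  by rewrite ger0_norm// ge_max ler_norm normr_ge0.
have [p Hp] : exists p, has_mean N (fun x : R => Num.max x 0) p.
  by apply: (has_mean_le _ _ Ha) => //; exact: (mmax _ (@measurable_id _ R setT)).
have [n Hn] : exists n, has_mean N (fun x : R => Num.max (- x) 0) n.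
  apply: (has_mean_le _ _ Ha); first exact: mmax.
  by move=> x; rewrite -[leRHS]normrN.
have pn : p = n.
  case: Hp => _ /=; case: Hn => _ /=.
  rewrite !ge0_integral_normal_prob//; last 2 first.
  - exact: (mmax _ (@measurable_id _ R setT)).
  - exact: mmax.
  rewrite ge0_lebesgue_integralN; last 2 first.
  - by apply: measurable_funM; [exact: mmax|exact: measurable_normal_pdf].
  - by move=> x; rewrite mulr_ge0// normal_pdf_ge0.
  under eq_integral => x _.
    rewrite opprK (_ : normal_pdf 0 s (- x) = normal_pdf 0 s x); last first.
      by rewrite !normal_pdfE// /normal_fun !subr0 sqrrN.
    over.
  by move=> -> [].
apply: (eq_has_mean _ _ (has_meanB Hp Hn)) => [x|]; last by rewrite pn subrr.
rewrite /=.
by case: (ltP x 0) => h; case: (ltP (- x) 0) => h'; lra.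
Qed.

(** A zero variance would concentrate the law on [[set 0]], which is null because the law is
    dominated by Lebesgue measure. *)
Lemma normal_prob_var_gt0 v : has_mean N (fun x : R => x ^+ 2) v -> 0 < v.
Proof.
move=> Hv; have v0 : 0 <= v by apply: has_mean_ge0 Hv => x; exact: sqr_ge0.
rewrite lt_neqAle v0 andbT; apply/negP => /eqP v_eq0.
have : (\int[N]_x `|(x ^+ 2)%:E| = 0)%E.
  by under eq_integral do rewrite gee0_abs ?lee_fin ?sqr_ge0//; case: Hv => _ ->; rewrite -v_eq0.
move=> /ae_eq_integral_abs => /(_ measurableT).
case; first by apply/measurable_EFinP; exact: measurable_funX.
move=> Z [mZ NZ hZ].
have N0 : N [set 0] = 0%E.
  have /null_content_dominatesP := @normal_prob_dominates R 0 s; apply => //.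
  exact: lebesgue_measure_set1.
have : (N setT <= N Z + N [set 0%R])%E.
  have m0 : @measurable _ (measurableTypeR R) [set (0 : R)] by exact: measurable_set1.
  apply: le_trans (measureU2 N mZ m0).
  apply: le_measure; rewrite ?inE//; first exact: measurableU.
  move=> x _; have [->|x0] := eqVneq x 0; first by right.
  left; apply: hZ => /= /(_ I) /eqP; rewrite eqe sqrf_eq0.
  by rewrite (negbTE x0).
by rewrite NZ N0 adde0 probability_setT lee_fin ler10.
Qed.

Lemma has_mean_normal_prob {d} {T : measurableType d} (P : probability T R)
    (X : {RV P >-> R}) (f : R -> R) m :
  (forall A : set R, measurable A -> distribution P X A = N A) ->
  has_mean N f m -> has_mean P (fun w => f (X w)) m.
Proof.
move=> XN Hf; have mf := has_mean_measurable Hf; case: Hf => fi fm.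
have mX : @measurable_fun _ _ T (measurableTypeR R) setT X.
  have mX : measurable_fun setT X by exact: measurable_funP.
  by move=> mT A; exact: (mX mT A).
have mEf : measurable_fun setT (EFin \o f) by exact/measurable_EFinP.
have distE (g : R -> \bar R) :
    (\int[pushforward P (X : T -> measurableTypeR R)]_x g x = \int[N]_x g x)%E.
  by apply: eq_measure_integral => A mA _; exact: XN.
have fXi : P.-integrable setT (EFin \o (f \o X)).
  apply/integrableP; split.
    by apply/measurable_EFinP; exact: (measurableT_comp mf mX).
  have mabs : @measurable_fun _ _ (measurableTypeR R) _ setT (fun x => `|(f x)%:E|)%E.
    by apply: measurableT_comp => //; exact: mEf.
  have := ge0_integral_pushforward mX P measurableT mabs.
  rewrite preimage_setT distE => <-; last by move=> ? _; exact: abse_ge0.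
  by case/integrableP : fi.
split=> //; rewrite -fm -distE.
by rewrite (integral_pushforward mX mEf).
Qed.

Lemma gaussian_moments : exists M : nat -> R,
  [/\ M 1%N = 0, 0 < M 2%N, M 2%N ^+ 2 <= M 4%N &
    forall d (T : measurableType d) (P : probability T R) (X : {RV P >-> R}),
    (forall A : set R, measurable A -> distribution P X A = N A) ->
    forall k, (k <= 4)%N -> has_mean P (fun w => X w ^+ k) (M k)].
Proof.
have /choice[M HM] k : exists m, (k <= 4)%N -> has_mean N (fun x : R => x ^+ k) m.
  by have [/normal_prob_pow[m ?]|_] := leqP k 4; [exists m|exists 0].
have uniq_mean f (m n : R) : has_mean N f m -> has_mean N f n -> m = n.
  by move=> [_ +] [_] => -> [].
exists M; split.
- by apply: (uniq_mean (@idfun R)); [exact: (HM 1%N)|exact: normal_prob_mean].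
- exact: normal_prob_var_gt0 (HM 2%N isT).
- have := has_meanD (HM 4%N isT) (has_meanD (has_meanZ (- 2 * M 2%N) (HM 2%N isT))
    (has_mean_cst N (M 2%N ^+ 2))).
  move/has_mean_ge0 => H; rewrite -subr_ge0.
  rewrite (_ : _ - _ = M 4%N + (- 2 * M 2%N * M 2%N + M 2%N ^+ 2)); last by ring.
  apply: H => x; rewrite (_ : _ + _ = (x ^+ 2 - M 2%N) ^+ 2) ?sqr_ge0//=.
  by ring.
- move=> d T P X XN k k4.
  exact: has_mean_normal_prob XN (HM k k4).
Qed.

End gaussian_moments.

(** * Quadratic forms in independent centred variables *)

Section quadratic_form.
Context {d} {T : measurableType d} {R : realType} (P : probability T R).
Variables (D : set nat) (X : nat -> {RV P >-> R}) (M : nat -> R).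
Hypothesis indX : mutually_independent P D X.
Hypothesis XM : forall i k, i \in D -> (k <= 4)%N -> has_mean P (fun w => X i w ^+ k) (M k).
Hypothesis M1 : M 1%N = 0.

Let v := M 2%N.
(** The fourth cumulant. Under [kurt] it is at least [- 2 * v ^+ 2]. *)
Let kappa := M 4%N - 3 * v ^+ 2.

Lemma has_mean_mul2 j k : j \in D -> k \in D ->
  has_mean P (fun w => X j w * X k w) (v * (j == k)%:R).
Proof.
move=> jD kD.
have sD : {subset [:: j; k] <= D} by move=> i; rewrite in_cons mem_seq1 => /orP[]/eqP->.
apply: (eq_has_mean _ _ (indep_has_mean_monomial indX sD (M := M) _)) => [w||].
- by rewrite !big_cons big_nil mulr1.
- rewrite /= mem_seq1; have [<-|jk] := eqVneq j k.
    by rewrite /= big_cons big_nil /= !eqxx /= mulr1.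
  by rewrite /= !big_cons big_nil /= !eqxx (negbTE jk) eq_sym (negbTE jk) /= !addn0 M1 mul0r mulr0.
- by move=> i n iD /leq_trans n2; apply: XM; [exact: sD|exact: n2].
Qed.

(** Wick's formula with a cumulant correction when all four indices agree: the three pairings then
    count [3 * v ^+ 2] and [kappa] restores [M 4]. An index that occurs only once kills the moment
    through [M1]. *)
Lemma has_mean_mul4 j k l m : j \in D -> k \in D -> l \in D -> m \in D ->
  has_mean P (fun w => X j w * X k w * (X l w * X m w))
    (v ^+ 2 * ((j == k)%:R * (l == m)%:R + (j == l)%:R * (k == m)%:R
               + (j == m)%:R * (k == l)%:R)
     + kappa * ((j == k)%:R * (j == l)%:R * (j == m)%:R)).
Proof.
move=> jD kD lD mD.
have sD : {subset [:: j; k; l; m] <= D}.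
  by move=> i; rewrite !in_cons in_nil orbF => /or4P[]/eqP->.
apply: (eq_has_mean _ _ (indep_has_mean_monomial indX sD (M := M) _)) => [w||].
- by rewrite !big_cons big_nil mulr1 !mulrA.
- rewrite /kappa /v /= !in_cons !in_nil !orbF.
  (* All six equalities are decided. Inconsistent choices leave some [a != a]; what survives are the
     partitions of the four indices. *)
  have [jk|jk] := eqVneq j k; have [jl|jl] := eqVneq j l;
  have [jm|jm] := eqVneq j m; have [kl|kl] := eqVneq k l;
  have [km|km] := eqVneq k m; have [lm|lm] := eqVneq l m;
  subst; try match goal with H : is_true (?a != ?a) |- _ => by rewrite eqxx in H end;
  repeat match goal with H : is_true (?a != ?b) |- _ =>
    have := negbTE H; have := negbTE H; rewrite {1}[a == b]eq_sym; clear H;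
    move=> ? ? end;
  repeat (match goal with
    | H : (?a == ?b) = false |- context [?a == ?b] => rewrite H
    | |- context [?a == ?a] => rewrite eqxx
    | |- context [\prod_(_ <- _ :: _) _] => rewrite big_cons
    | _ => progress rewrite /= ?addn0 ?add0n ?big_nil
    end);
  rewrite ?M1; try ring.
- by move=> i n iD n4; apply: XM => //; exact: sD.
Qed.

Variables (s : seq nat) (A : nat -> nat -> R).
Hypotheses (us : uniq s) (sD : {subset s <= D}).

Let sum_delta (F : nat -> R) (a : nat) : a \in s ->
  \sum_(m <- s) F m * (a == m)%:R = F a.
Proof.
move=> sa; rewrite (bigD1_seq a)//= eqxx mulr1 big1 ?addr0// => m.
by rewrite eq_sym => /negbTE ->; rewrite mulr0.
Qed.

Let Q w := \sum_(j <- s) \sum_(k <- s) A j k * (X j w * X k w).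
Let tr := \sum_(j <- s) A j j.

Lemma has_mean_quadratic : has_mean P Q (v * tr).
Proof.
have : has_mean P Q (\sum_(j <- s) \sum_(k <- s) A j k * (v * (j == k)%:R)).
  apply: has_mean_sum => j sj; apply: has_mean_sum => k sk.
  by apply: has_meanZ; apply: has_mean_mul2; exact: sD.
apply: eq_has_mean => //; rewrite mulr_sumr; apply: eq_big_seq => j sj.
by under eq_bigr do rewrite mulrCA mulrA; rewrite sum_delta.
Qed.

Lemma has_mean_quadratic_sqr : has_mean P (fun w => Q w ^+ 2)
  (v ^+ 2 * (tr ^+ 2 + \sum_(j <- s) \sum_(k <- s) A j k * (A j k + A k j))
   + kappa * \sum_(j <- s) A j j ^+ 2).
Proof.
have QQ w : \sum_(j <- s) \sum_(k <- s) \sum_(l <- s) \sum_(m <- s)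
    A j k * A l m * (X j w * X k w * (X l w * X m w)) = Q w ^+ 2.
  rewrite expr2 {1}/Q mulr_suml; apply: eq_bigr => j _.
  rewrite mulr_suml; apply: eq_bigr => k _.
  rewrite mulr_sumr; apply: eq_bigr => l _.
  by rewrite mulr_sumr; apply: eq_bigr => m _; rewrite mulrACA.
apply: (eq_has_mean QQ (m := \sum_(j <- s) \sum_(k <- s) \sum_(l <- s) \sum_(m <- s)
    A j k * A l m * (v ^+ 2 * ((j == k)%:R * (l == m)%:R + (j == l)%:R * (k == m)%:R
               + (j == m)%:R * (k == l)%:R)
     + kappa * ((j == k)%:R * (j == l)%:R * (j == m)%:R)))); last first.
  do 4 (apply: has_mean_sum => ? ?); apply: has_meanZ.
  by apply: has_mean_mul4; exact: sD.
have inner j k : j \in s -> k \in s -> \sum_(l <- s) \sum_(m <- s)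
    A j k * A l m * (v ^+ 2 * ((j == k)%:R * (l == m)%:R + (j == l)%:R * (k == m)%:R
               + (j == m)%:R * (k == l)%:R)
     + kappa * ((j == k)%:R * (j == l)%:R * (j == m)%:R)) =
    A j k * (v ^+ 2 * tr + kappa * A j j) * (j == k)%:R
     + v ^+ 2 * (A j k * (A j k + A k j)).
  move=> sj sk.
  have row l : l \in s -> \sum_(m <- s)
      A j k * A l m * (v ^+ 2 * ((j == k)%:R * (l == m)%:R + (j == l)%:R * (k == m)%:R
               + (j == m)%:R * (k == l)%:R)
       + kappa * ((j == k)%:R * (j == l)%:R * (j == m)%:R)) =
      A j k * (j == k)%:R * v ^+ 2 * A l l
      + A j k * (v ^+ 2 * A l k + kappa * (j == k)%:R * A l j) * (j == l)%:R
      + A j k * v ^+ 2 * A l j * (k == l)%:R.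
    move=> sl.
    (* Regrouped by the one delta that pins [m] in each term, so that [sum_delta] removes the sum
       over [m]. *)
    transitivity (\sum_(m <- s)
        (A j k * (j == k)%:R * v ^+ 2 * A l m * (l == m)%:R
         + A j k * (j == l)%:R * v ^+ 2 * A l m * (k == m)%:R
         + (A j k * v ^+ 2 * (k == l)%:R + A j k * kappa * (j == k)%:R * (j == l)%:R)
           * A l m * (j == m)%:R)).
      by apply: eq_bigr => m _; ring.
    by rewrite !big_split /= !sum_delta//; ring.
  rewrite (eq_big_seq _ row) !big_split /= !sum_delta// -mulr_sumr -/tr.
  ring.
under eq_big_seq => j sj.
  rewrite (eq_big_seq _ (fun k sk => inner j k sj sk)) big_split /= sum_delta//.
  rewrite -mulr_sumr mulrDr.
  over.
rewrite /= 2!big_split /= -[in LHS]mulr_suml -/tr -mulr_sumr.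
rewrite (_ : \sum_(i <- s) A i i * (kappa * A i i) = kappa * \sum_(j <- s) A j j ^+ 2).
  ring.
by rewrite mulr_sumr; apply: eq_bigr => j _; ring.
Qed.

Definition quadratic_mse c :=
  (v * tr - c) ^+ 2 + v ^+ 2 * \sum_(j <- s) \sum_(k <- s) A j k * (A j k + A k j)
  + kappa * \sum_(j <- s) A j j ^+ 2.

Lemma has_mean_quadratic_mse c : has_mean P (fun w => (Q w - c) ^+ 2) (quadratic_mse c).
Proof.
apply: (eq_has_mean _ _ (has_meanD has_mean_quadratic_sqr
  (has_meanD (has_meanZ (- 2 * c) has_mean_quadratic) (has_mean_cst P (c ^+ 2))))).
- by move=> w /=; ring.
- by rewrite /quadratic_mse; ring.
Qed.

Hypothesis kurt : v ^+ 2 <= M 4%N.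

(** [A j k * A k j] is at most the half sum of the two squares, and [kappa <= M 4] acts on a
    diagonal that is part of the Frobenius norm. *)
Lemma quadratic_mse_le c : quadratic_mse c <=
  (v * tr - c) ^+ 2
  + (2 * v ^+ 2 + M 4%N) * \sum_(j <- s) \sum_(k <- s) A j k ^+ 2.
Proof.
have sumC : \sum_(j <- s) \sum_(k <- s) A k j ^+ 2 = \sum_(j <- s) \sum_(k <- s) A j k ^+ 2.
  by rewrite exchange_big.
have h1 : \sum_(j <- s) \sum_(k <- s) A j k * (A j k + A k j)
    <= 2 * \sum_(j <- s) \sum_(k <- s) A j k ^+ 2.
  apply: (@le_trans _ _ (\sum_(j <- s) \sum_(k <- s)
      (3 / 2 * A j k ^+ 2 + 2^-1 * A k j ^+ 2))).
    apply: ler_sum => j _; apply: ler_sum => k _.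
    by have := sqr_ge0 (A j k - A k j); lra.
  under eq_bigr do rewrite big_split /= -!mulr_sumr.
  by rewrite big_split /= -!mulr_sumr sumC; lra.
have h2 : \sum_(j <- s) A j j ^+ 2 <= \sum_(j <- s) \sum_(k <- s) A j k ^+ 2.
  rewrite big_seq [leRHS]big_seq; apply: ler_sum => j sj.
  rewrite -(sum_delta (fun k => A j k ^+ 2) sj); apply: ler_sum => k _.
  by case: eqP => _; rewrite ?mulr1 ?mulr0 ?sqr_ge0.
have h3 : 0 <= \sum_(j <- s) A j j ^+ 2 by apply: sumr_ge0 => j _; exact: sqr_ge0.
have v2 : 0 <= v ^+ 2 by exact: sqr_ge0.
rewrite /quadratic_mse /kappa -addrA lerD2l.
move: (\sum_(j <- s) \sum_(k <- s) A j k * (A j k + A k j)) (\sum_(j <- s) A j j ^+ 2)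
  (\sum_(j <- s) \sum_(k <- s) A j k ^+ 2) (v ^+ 2) (M 4%N) h1 h2 h3 v2 kurt => a b e x y.
nra.
Qed.

Lemma quadratic_mse_ge c :
  v ^+ 2 / 2 * \sum_(j <- s) \sum_(k <- s | (k < j)%N) (A j k + A k j) ^+ 2
  <= quadratic_mse c.
Proof.
have sumC : \sum_(j <- s) \sum_(k <- s) A k j ^+ 2 = \sum_(j <- s) \sum_(k <- s) A j k ^+ 2.
  by rewrite exchange_big.
have h1 : 2 * \sum_(j <- s) \sum_(k <- s) A j k * (A j k + A k j) =
    \sum_(j <- s) \sum_(k <- s) (A j k + A k j) ^+ 2.
  transitivity (\sum_(j <- s) \sum_(k <- s)
      (A j k ^+ 2 + 2 * (A j k * A k j) + A k j ^+ 2)).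
    rewrite mulr_sumr.
    under eq_bigr => j _.
      rewrite mulr_sumr; under eq_bigr => k _.
        rewrite (_ : 2 * _ = A j k ^+ 2 + 2 * (A j k * A k j) + A j k ^+ 2); last by ring.
        over.
      rewrite big_split /=; over.
    rewrite big_split /= -sumC -big_split /=; apply: eq_bigr => j _.
    by rewrite -big_split.
  by apply: eq_bigr => j _; apply: eq_bigr => k _; ring.
have h2 : \sum_(j <- s) \sum_(k <- s | (k < j)%N) (A j k + A k j) ^+ 2
    + 4 * \sum_(j <- s) A j j ^+ 2 <=
    \sum_(j <- s) \sum_(k <- s) (A j k + A k j) ^+ 2.
  rewrite mulr_sumr -big_split /= big_seq [leRHS]big_seq; apply: ler_sum => j sj.
  rewrite [leRHS](bigD1_seq j)//= [X in _ <= X](_ : _ = \sum_(k <- s | k != j) (A j k + A k j) ^+ 2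
    + 4 * A j j ^+ 2); last by ring.
  rewrite lerD2r [leLHS]big_mkcond [leRHS]big_mkcond /=; apply: ler_sum => k _.
  by case: (ltngtP k j) => _; rewrite ?sqr_ge0.
have h3 : 0 <= \sum_(j <- s) A j j ^+ 2 by apply: sumr_ge0 => j _; exact: sqr_ge0.
have v2 : 0 <= v ^+ 2 by exact: sqr_ge0.
have c2 := sqr_ge0 (v * tr - c).
rewrite /quadratic_mse /kappa.
move: (\sum_(j <- s) \sum_(k <- s) A j k * (A j k + A k j)) (\sum_(j <- s) A j j ^+ 2)
  (\sum_(j <- s) \sum_(k <- s | (k < j)%N) (A j k + A k j) ^+ 2)
  (\sum_(j <- s) \sum_(k <- s) (A j k + A k j) ^+ 2)
  (v ^+ 2) (M 4%N) ((v * tr - c) ^+ 2) h1 h2 h3 v2 c2 kurt => a b e f x y z.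
nra.
Qed.

End quadratic_form.

(** * Linear filters *)

Lemma cauchy_schwarz_weighted {R : realFieldType} (I : Type) (s : seq I) (a b : I -> R) :
  (forall i, 0 <= a i) ->
  (\sum_(i <- s) a i * b i) ^+ 2 <= (\sum_(i <- s) a i) * (\sum_(i <- s) a i * b i ^+ 2).
Proof.
move=> a0; elim: s => [|i s ih]; first by rewrite !big_nil expr0n mulr0.
rewrite !big_cons.
have S0 : 0 <= \sum_(j <- s) a j by apply: sumr_ge0.
(* Times [a i], this is exactly what the gap between the two sides gains when [i] is added. *)
have q0 : 0 <= \sum_(j <- s) a j * (b j - b i) ^+ 2.
  by apply: sumr_ge0 => j _; rewrite mulr_ge0 ?sqr_ge0.
have qE : \sum_(j <- s) a j * (b j - b i) ^+ 2 = \sum_(j <- s) a j * b j ^+ 2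
    - 2 * b i * \sum_(j <- s) a j * b j + b i ^+ 2 * \sum_(j <- s) a j.
  rewrite !mulr_sumr -sumrB -big_split /=; apply: eq_bigr => j _; ring.
have := mulr_ge0 (a0 i) q0; rewrite qE.
move: (\sum_(j <- s) a j) (\sum_(j <- s) a j * b j) (\sum_(j <- s) a j * b j ^+ 2) ih S0 => x y z.
nra.
Qed.

Lemma ler_sum_subrange {R : numDomainType} (F : nat -> R) (a b c d : nat) :
  (forall i, 0 <= F i) -> (a <= b)%N -> (c <= d)%N ->
  \sum_(b <= i < c) F i <= \sum_(a <= i < d) F i.
Proof.
move=> F0 ab cd; have [cb|bc] := leqP c b; first by rewrite big_geq// sumr_ge0.
rewrite (@big_cat_nat _ _ _ b a d)//=; last by lia.
rewrite (@big_cat_nat _ _ _ c b d)//=; last by lia.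
by rewrite -[leLHS]add0r lerD ?sumr_ge0// lerDl sumr_ge0.
Qed.

Section linear_filter.
Context {R : realType}.
Variables (h : nat -> R) (ell : nat -> nat).

(* The weights of [e_p] in [X_i] ([coef p i]), of [e_q] in [W_i] ([wcoef i q]), and of
   [e_p e_q] in [n * sigma_hat_n] ([Amat n p q]). *)
Fixpoint coef (p i : nat) : R :=
  match i with
  | 0 => 0
  | i'.+1 => (1 - h i'.+1) * coef p i' + h i'.+1 * (p == i'.+1)%:R
  end.

Definition decay (i j : nat) : R := \prod_(i.+1 <= m < j.+1) (1 - h m).

Definition wcoef (i q : nat) : R := \sum_((i.+1 - ell i)%N <= j < i) coef q j.

Definition Amat (n p q : nat) : R :=
  \sum_(1 <= i < n.+1) coef p i * (coef q i + 2 * wcoef i q).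

Lemma coef_lt p i : (i < p)%N -> coef p i = 0.
Proof.
elim: i => [//|i ih] ip /=; rewrite ih 1?ltnW// mulr0 add0r.
by rewrite gtn_eqF// mulr0.
Qed.

Lemma coefS p i : (p <= i)%N -> coef p i.+1 = (1 - h i.+1) * coef p i.
Proof. by move=> pi /=; rewrite ltn_eqF ?ltnS// mulr0 addr0. Qed.

Lemma coef_diag p : (0 < p)%N -> coef p p = h p.
Proof. by case: p => //= p _; rewrite coef_lt// mulr0 add0r eqxx mulr1. Qed.

Lemma decayS i j : (i <= j)%N -> decay i j.+1 = decay i j * (1 - h j.+1).
Proof. by move=> ij; rewrite /decay big_nat_recr. Qed.

Lemma decayii i : decay i i = 1. Proof. by rewrite /decay big_geq. Qed.

Lemma coef_decay p i j : (p <= i <= j)%N -> coef p j = decay i j * coef p i.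
Proof.
move=> /andP[pi]; elim: j => [|j ih].
  by rewrite leqn0 => /eqP ->; rewrite decayii mul1r.
rewrite leq_eqVlt => /orP[/eqP <-|]; first by rewrite decayii mul1r.
rewrite ltnS => ij; rewrite coefS ?(leq_trans pi)// ih// decayS//.
by rewrite mulrCA mulrA.
Qed.

(** Innovations later than [i] have weight 0, so all [X_i] with [i <= n] can be expanded over one
    common index range. *)
Lemma Xseq_coef (T : Type) (eta alpha : R) (e : nat -> T -> R) w n i :
  h =1 step eta alpha -> (i <= n)%N ->
  Xseq eta alpha e i w = \sum_(1 <= p < n.+1) coef p i * e p w.
Proof.
move=> hE; elim: i => [_|i ih lin] /=.
  by rewrite big1// => p _; rewrite mul0r.
rewrite ih 1?ltnW// -hE.
rewrite [RHS](eq_bigr (fun p => (1 - h i.+1) * (coef p i * e p w)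
    + (p == i.+1)%:R * (h i.+1 * e p w))); last by move=> p _; ring.
rewrite big_split /= -mulr_sumr; congr (_ + _).
rewrite (bigD1_seq i.+1) ?iota_uniq ?mem_index_iota//= eqxx mul1r big1 ?addr0//.
by move=> p /negbTE ->; rewrite mul0r.
Qed.

Hypothesis h_gt0 : forall i, (0 < i)%N -> 0 < h i.
Variable N0 : nat.
Hypothesis N0_gt0 : (0 < N0)%N.
Hypothesis h_le1 : forall i, (N0 <= i)%N -> h i <= 1.

Lemma decay_ge0 i j : (N0 <= i.+1)%N -> 0 <= decay i j.
Proof.
move=> Ni; rewrite /decay big_seq; apply: prodr_ge0 => m.
by rewrite mem_index_iota => /andP[im _]; rewrite subr_ge0 h_le1// (leq_trans Ni).
Qed.

Lemma coef_ge0 p i : (N0 <= p)%N -> 0 <= coef p i.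
Proof.
move=> Np; have [/coef_lt ->//|pi] := ltnP i p.
rewrite (@coef_decay p p i) ?leqnn// coef_diag ?(leq_trans N0_gt0)//.
by rewrite mulr_ge0// ?decay_ge0 ?(leqW Np)// ltW// h_gt0// (leq_trans N0_gt0).
Qed.

Lemma coef_col_bound : exists2 K : R, 0 <= K &
  forall i n, \sum_(1 <= p < n.+1) `|coef p i| <= K.
Proof.
(* A majorant of the sum over [p] that is free of [n]. Once [h <= 1] its recursion is a convex
   combination of [b i] and 1, so it never exceeds a [K] that is at least 1 and at least [b N0]. *)
pose b := fix b i : R := if i is i'.+1 then `|1 - h i'.+1| * b i' + h i'.+1 else 0.
have b0 i : 0 <= b i.
  elim: i => //= i ih; rewrite addr_ge0 ?mulr_ge0 ?normr_ge0//.
  by rewrite ltW ?h_gt0.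
have leb n i : \sum_(1 <= p < n.+1) `|coef p i| <= b i.
  elim: i => [|i ih] /=.
    by rewrite big1// => p _; rewrite normr0.
  apply: (@le_trans _ _ (`|1 - h i.+1| * \sum_(1 <= p < n.+1) `|coef p i|
     + h i.+1 * \sum_(1 <= p < n.+1) (p == i.+1)%:R)).
    rewrite !mulr_sumr -big_split /=; apply: ler_sum => p _.
    rewrite (le_trans (ler_normD _ _))// !normrM lerD2l.
    by rewrite (ger0_norm (ltW (h_gt0 _)))// ger0_norm.
  apply: lerD; first by rewrite ler_wpM2l.
  rewrite -[leRHS]mulr1 ler_wpM2l//; first by rewrite ltW ?h_gt0.
  have [i1n|i1n] := boolP (i.+1 \in index_iota 1 n.+1).
    rewrite (bigD1_seq i.+1) ?iota_uniq//= eqxx big1 ?addr0// => p /negbTE -> //.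
  rewrite big1_seq// => p /andP[_ pn]; case: eqP => // pi.
  by rewrite -pi pn in i1n.
pose K := 1 + \sum_(0 <= i < N0.+1) b i.
exists K; first by rewrite addr_ge0// sumr_ge0.
move=> i n; apply: le_trans (leb n i) _.
have [iN|] := leqP i N0.
  rewrite /K (bigD1_seq i) ?iota_uniq ?mem_index_iota//= addrCA lerDl.
  by rewrite addr_ge0// sumr_ge0.
have K1 : 1 <= K by rewrite lerDl sumr_ge0.
have bN : b N0 <= K.
  rewrite /K (bigD1_seq N0) ?iota_uniq ?mem_index_iota ?ltnS//= addrCA lerDl.
  by rewrite addr_ge0// sumr_ge0.
elim: i => // i ih; rewrite ltnS => Ni /=.
have biK : b i <= K by move: Ni; rewrite leq_eqVlt => /orP[/eqP <-//|].
have hi1 : h i.+1 <= 1 by rewrite h_le1// leqW.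
have hi0 := h_gt0 (ltn0Sn i).
rewrite ger0_norm ?subr_ge0//; nra.
Qed.

Hypothesis h_slow : forall i, (N0 <= i)%N -> (h i.+1)^-1 - (h i)^-1 <= 2^-1.

Lemma coef_row_bound : exists2 K : R, 0 <= K &
  forall p n, (0 < p)%N -> \sum_(0 <= i < n.+1) `|coef p i| <= K.
Proof.
have [K K0 leK] := coef_col_bound.
have coefK p i : (0 < p)%N -> `|coef p i| <= K.
  move=> p0; apply: le_trans (leK i p).
  rewrite (bigD1_seq p) ?iota_uniq ?mem_index_iota ?p0 ?ltnS//= lerDl.
  by rewrite sumr_ge0.
have hN0 := h_gt0 N0_gt0.
(* The first [N0] terms cost [K] each; the rest is twice the initial potential plus the unit
   injected when [e_p] enters. *)
pose K' := N0%:R * K + 2 * (K / h N0 + 1).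
have K'0 : 0 <= K' by rewrite addr_ge0 ?mulr_ge0 ?addr_ge0 ?divr_ge0// ltW.
exists K' => // p n p0.
(* One step turns [|coef p m| / h m] into at most itself minus [|coef p m|] plus [|coef p m| / 2],
   the last term from [h_slow]; the net loss pays for half of the row sum. The indicator asks for
   [N0 < p] because an earlier [e_p] is already in the initial potential. *)
have pot m : (N0 <= m)%N -> 2^-1 * \sum_(N0 <= i < m) `|coef p i| + `|coef p m| / h m
    <= K / h N0 + ((N0 < p) && (p <= m))%N%:R.
  elim: m => [|m ih]; first by rewrite leqNgt N0_gt0.
  rewrite leq_eqVlt => /orP[/eqP <-|].
    rewrite big_geq// mulr0 add0r.
    rewrite (_ : _ && _ = false) ?addr0; last by lia.
    by rewrite ler_wpM2r ?coefK// invr_ge0 ltW.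
  rewrite ltnS => Nm; have {ih} := ih Nm.
  rewrite big_nat_recr//= => ih.
  have hm := h_gt0 (leq_trans N0_gt0 Nm).
  have hm1 := h_gt0 (ltn0Sn m).
  have hm1le : h m.+1 <= 1 by rewrite h_le1// leqW.
  have slow := h_slow Nm.
  have am0 : 0 <= `|coef p m| by [].
  have aS : `|(1 - h m.+1) * coef p m + h m.+1 * (p == m.+1)%:R| / h m.+1 <=
      `|coef p m| * (h m.+1)^-1 - `|coef p m| + (p == m.+1)%:R.
    rewrite ler_pdivrMr// (le_trans (ler_normD _ _))// !normrM.
    rewrite [`|1 - _|]ger0_norm ?subr_ge0// (gtr0_norm hm1) [`|_%:R|]ger0_norm//.
    move: (`|coef p m|) (h m.+1) hm1 ((p == m.+1)%:R : R) => a b b0 x.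
    rewrite (_ : (a / b - a + x) * b = a - a * b + x * b); first by lra.
    by field; rewrite gt_eqF.
  have ind : ((N0 < p) && (p <= m))%N%:R + (p == m.+1)%:R
      <= ((N0 < p) && (p <= m.+1))%N%:R :> R.
    by rewrite -natrD ler_nat; clear - Nm; lia.
  have : `|coef p m| * ((h m.+1)^-1 - (h m)^-1) <= `|coef p m| * 2^-1.
    by rewrite ler_wpM2l.
  rewrite mulrBr; lra.
have tail m : (N0 <= m)%N -> \sum_(N0 <= i < m) `|coef p i| <= 2 * (K / h N0 + 1).
  move=> Nm; have := pot m Nm.
  have : 0 <= `|coef p m| / h m.
    by rewrite divr_ge0// ltW// h_gt0// (leq_trans N0_gt0).
  have : ((N0 < p) && (p <= m))%N%:R <= 1 :> R by rewrite lern1 leq_b1.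
  lra.
apply: (@le_trans _ _ (\sum_(0 <= i < maxn N0 n.+1) `|coef p i|)).
  by apply: ler_sum_subrange => //; rewrite leq_maxr.
rewrite (@big_cat_nat _ _ _ N0)//= ?leq_maxl// lerD ?tail ?leq_maxl//.
apply: (@le_trans _ _ (\sum_(0 <= i < N0) K)).
  by apply: ler_sum => i _; exact: coefK.
by rewrite sumr_const_nat subn0 mulr_natl.
Qed.

End linear_filter.

(** * Bounds on the matrix of the quadratic form *)

Section filter_estimates.
Context {R : realType}.
Variables (h : nat -> R) (ell : nat -> nat) (N0 : nat).
Hypothesis h_gt0 : forall i, (0 < i)%N -> 0 < h i.
Hypothesis N0_gt0 : (0 < N0)%N.
Hypothesis h_le1 : forall i, (N0 <= i)%N -> h i <= 1.

(** Bernoulli's inequality for [g] factors, each at least [1 - theta]. *)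
Lemma decay_ge i g (theta : R) : (N0 <= i)%N -> theta <= 1 ->
  (forall m, (i < m <= i + g)%N -> h m <= theta) -> 1 - g%:R * theta <= decay h i (i + g).
Proof.
move=> Ni t1; elim: g => [|g ih] hm; first by rewrite addn0 decayii mul0r subr0.
rewrite addnS decayS ?leq_addr//.
have ht : h (i + g).+1 <= theta by apply: hm; lia.
have h1 : h (i + g).+1 <= 1 by exact: le_trans ht t1.
have hp : 0 < h (i + g).+1 by exact: h_gt0.
have d0 : 0 <= decay h i (i + g) by apply: (decay_ge0 h_le1); exact: leqW.
have d1 : decay h i (i + g) <= 1.
  rewrite /decay big_seq; apply: prodr_ile1 => m; rewrite mem_index_iota => /andP[im _].
  have hm0 := h_gt0 (leq_ltn_trans (leq0n _) im).
  have hm1 : h m <= 1 by apply: h_le1; lia.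
  by apply/andP; split; lra.
have {ih} := ih (fun m im => hm m ltac:(lia)).
rewrite -addn1 natrD; nra.
Qed.

(* Only the summands with [p <= i <= p + g] are kept: there the filter has not yet decayed. *)
Lemma Amat_entry_ge lo n g (lam theta : R) p q : (N0 <= lo)%N -> theta <= 1 ->
  g%:R * theta <= 2^-1 -> 0 <= lam ->
  (forall m, (lo <= m <= n)%N -> lam <= h m <= theta) ->
  (lo <= q)%N -> (q + g < p)%N -> (p + g <= n)%N ->
  (forall i, (p <= i <= p + g)%N -> (i.+1 - ell i <= q)%N) ->
  2^-1 * (g.+1%:R * lam) ^+ 2 <= Amat h ell n p q.
Proof.
move=> Nlo t1 gt lam0 hm loq qp pn win.
have Nq : (N0 <= q)%N by exact: leq_trans loq.
have Np : (N0 <= p)%N by lia.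
have c0 r i : (N0 <= r)%N -> 0 <= coef h r i by exact: coef_ge0.
have cge r i : (lo <= r)%N -> (r + g <= n)%N -> (r <= i <= r + g)%N ->
    2^-1 * lam <= coef h r i.
  move=> lor rn /andP[ri irg].
  have Nr : (N0 <= r)%N by exact: leq_trans lor.
  rewrite (@coef_decay _ _ r r i) ?leqnn// coef_diag ?(leq_trans N0_gt0)//.
  have /andP[lamh _] : lam <= h r <= theta by apply: hm; lia.
  have := @decay_ge r (i - r) theta Nr t1.
  rewrite subnKC// => H.
  have dge : 2^-1 <= decay h r i.
    apply: le_trans (H _); last by move=> m rm; have /andP[] := hm m ltac:(lia).
    have tge0 : 0 <= theta.
      by have /andP[l1 l2] := hm r ltac:(lia); lra.
    have : (i - r)%:R * theta <= g%:R * theta.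
      by rewrite ler_wpM2r// ler_nat; lia.
    by lra.
  nra.
have w0 i : 0 <= wcoef h ell i q by apply: sumr_ge0 => j _; exact: c0.
(* [q + g < p <= i] puts the times from [q] to [q + g] before [i], and [win] puts them inside the
   window. *)
have wge i : (p <= i <= p + g)%N -> g.+1%:R * (2^-1 * lam) <= wcoef h ell i q.
  move=> ip; apply: (@le_trans _ _ (\sum_(q <= j < q + g.+1) coef h q j)).
    rewrite mulr_natl -[in leLHS](addKn q g.+1) -sumr_const_nat big_nat [leRHS]big_nat.
    by apply: ler_sum => j jq; apply: cge; lia.
  by apply: ler_sum_subrange => [j||]; [exact: c0|exact: win|lia].
have c0' i := c0 p i Np.
(* There are [g + 1] times [i], each worth [lam / 2] times twice [(g + 1) * lam / 2]. *)
apply: (@le_trans _ _ (\sum_(p <= i < p + g.+1) coef h p i * (coef h q i + 2 * wcoef h ell i q))).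
  apply: (@le_trans _ _ (\sum_(p <= i < p + g.+1) 2^-1 * (g.+1%:R * lam ^+ 2))).
    by rewrite sumr_const_nat addKn -[leRHS]mulr_natl exprMn; lra.
  rewrite big_nat [leRHS]big_nat; apply: ler_sum => i ip.
  have := cge p i ltac:(lia) pn ltac:(lia).
  have := wge i ltac:(lia).
  have := c0 q i Nq.
  have : 0 <= g.+1%:R :> R by [].
  move: (coef h q i) (coef h p i) (wcoef h ell i q) (g.+1%:R : R) => b a w G G0 b0 wG bl.
  have l0 : 0 <= 2^-1 * lam by rewrite mulr_ge0.
  have aw : 2^-1 * lam * (G * (2^-1 * lam)) <= a * w.
    by apply: ler_pM => //; exact: mulr_ge0.
  have a0 : 0 <= a by exact: le_trans bl.
  have := mulr_ge0 a0 b0; lra.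
apply: ler_sum_subrange => [i||]; [|lia|lia].
by rewrite mulr_ge0// addr_ge0 ?mulr_ge0// c0.
Qed.

(** The pairs kept are [n - 2k <= p < n - k] and [p - g - l <= q < p - g]. Since [g <= k], times up
    to [p + g] stay below [n]; reaching back from there to [q] takes at most [2g + l + 1] indices,
    whence the demand on [ell]. The entry at [(q, p)] is only used through its sign. *)
Lemma Amat_offdiag_ge lo n k g l (lam theta : R) : (N0 <= lo)%N -> theta <= 1 ->
  g%:R * theta <= 2^-1 -> 0 <= lam ->
  (forall m, (lo <= m <= n)%N -> lam <= h m <= theta) ->
  (g <= k)%N -> (lo + 2 * k + g + l <= n)%N ->
  (forall i, (lo <= i <= n)%N -> (2 * g + l < ell i)%N) ->
  (k * l)%:R * (2^-1 * (g.+1%:R * lam) ^+ 2) ^+ 2 <=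
  \sum_(1 <= p < n.+1) \sum_(1 <= q < n.+1 | (q < p)%N)
    (Amat h ell n p q + Amat h ell n q p) ^+ 2.
Proof.
move=> Nlo t1 gt lam0 hm gk lon lell.
set B := 2^-1 * _.
have B0 : 0 <= B by rewrite mulr_ge0 ?sqr_ge0.
have A0 p q : (N0 <= p)%N -> (N0 <= q)%N -> 0 <= Amat h ell n p q.
  move=> Np Nq; apply: sumr_ge0 => i _.
  by rewrite mulr_ge0 ?addr_ge0 ?mulr_ge0 ?(coef_ge0 h_gt0 N0_gt0 h_le1)//;
    apply: sumr_ge0 => j _; exact: (coef_ge0 h_gt0 N0_gt0 h_le1).
apply: (@le_trans _ _ (\sum_(n - 2 * k <= p < n - k) l%:R * B ^+ 2)).
  rewrite sumr_const_nat (_ : _ - _ = k)%N; last by lia.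
  by rewrite -[leRHS]mulr_natl natrM mulrA.
pose F p := \sum_(1 <= q < n.+1 | (q < p)%N)
  (Amat h ell n p q + Amat h ell n q p) ^+ 2.
have F0 p : 0 <= F p by apply: sumr_ge0 => q _; exact: sqr_ge0.
apply: (@le_trans _ _ (\sum_(n - 2 * k <= p < n - k) F p)); last first.
  by apply: (ler_sum_subrange F0); lia.
rewrite big_nat [leRHS]big_nat; apply: ler_sum => p pk.
rewrite /F big_mkcond /=.
apply: (@le_trans _ _ (\sum_(p - g - l <= q < p - g)
    if (q < p)%N then (Amat h ell n p q + Amat h ell n q p) ^+ 2 else 0)); last first.
  by apply: ler_sum_subrange => [q||]; [case: ifP => _ //; exact: sqr_ge0|lia|lia].
apply: (@le_trans _ _ (\sum_(p - g - l <= q < p - g) B ^+ 2)).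
  by rewrite sumr_const_nat (_ : _ - _ = l)%N ?mulr_natl//; lia.
rewrite big_nat [leRHS]big_nat; apply: ler_sum => q qp.
rewrite ifT; last by lia.
have Aqp : 0 <= Amat h ell n q p by apply: A0; lia.
have : B <= Amat h ell n p q.
  apply: (@Amat_entry_ge lo n g lam theta) => //; try lia.
  by move=> i ip; have := lell i ltac:(lia); lia.
by move=> BA; rewrite lerXn2r ?nnegrE//; lra.
Qed.

Hypothesis h_slow : forall i, (N0 <= i)%N -> (h i.+1)^-1 - (h i)^-1 <= 2^-1.

(* Schur test: Cauchy-Schwarz with weights [|coef p i|], whose row and column sums are
   bounded. *)
Lemma Amat_frobenius_le : exists2 K : R, 0 <= K & forall n,
  \sum_(1 <= p < n.+1) \sum_(1 <= q < n.+1) Amat h ell n p q ^+ 2 <=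
  K * \sum_(1 <= i < n.+1) (1 + (ell i)%:R).
Proof.
have [K1 K10 col] := coef_col_bound h_gt0 h_le1.
have [K2 K20 row] := coef_row_bound h_gt0 N0_gt0 h_le1 h_slow.
exists (4 * K1 ^+ 2 * K2 ^+ 2); first by rewrite !mulr_ge0 ?sqr_ge0.
(* [u i q] dominates the cofactor of [coef p i] in [Amat]. Its sum over [q] is of order [ell i]
   ([uS]) while its values are bounded ([uK]), so its squares also sum to order [ell i] ([uS2]). *)
move=> n; pose u i q := `|coef h q i| + 2 * \sum_(i.+1 - ell i <= j < i) `|coef h q j|.
have u0 i q : 0 <= u i q by rewrite addr_ge0 ?mulr_ge0 ?sumr_ge0.
have uK i q : (0 < q)%N -> u i q <= 2 * K2.
  move=> q0; apply: le_trans (_ : 2 * \sum_(0 <= j < i.+1) `|coef h q j| <= _).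
    rewrite [X in 2 * X]big_nat_recr//= /u.
    have : \sum_(i.+1 - ell i <= j < i) `|coef h q j| <= \sum_(0 <= j < i) `|coef h q j|.
      exact: ler_sum_subrange.
    have : 0 <= `|coef h q i| by [].
    lra.
  by rewrite ler_wpM2l// row.
have uS i : \sum_(1 <= q < n.+1) u i q <= 2 * K1 * (1 + (ell i)%:R).
  rewrite big_split /= -mulr_sumr exchange_big /=.
  have : \sum_(i.+1 - ell i <= j < i) \sum_(1 <= q < n.+1) `|coef h q j| <= (ell i)%:R * K1.
    apply: (@le_trans _ _ (\sum_(i.+1 - ell i <= j < i) K1)).
      by apply: ler_sum => j _; exact: col.
    by rewrite sumr_const_nat -[leLHS]mulr_natl ler_wpM2r// ler_nat; lia.
  have := col i n; lra.
have uS2 i : \sum_(1 <= q < n.+1) u i q ^+ 2 <= 4 * K1 * K2 * (1 + (ell i)%:R).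
  apply: (@le_trans _ _ (\sum_(1 <= q < n.+1) 2 * K2 * u i q)).
    rewrite big_nat [leRHS]big_nat; apply: ler_sum => q /andP[q0 _].
    by rewrite expr2 ler_wpM2r// uK.
  rewrite -mulr_sumr; apply: le_trans (ler_wpM2l _ (uS i)) _; first by rewrite mulr_ge0.
  by rewrite le_eqVlt; apply/orP; left; apply/eqP; ring.
have entry p q : (0 < p)%N ->
    Amat h ell n p q ^+ 2 <= K2 * \sum_(1 <= i < n.+1) `|coef h p i| * u i q ^+ 2.
  move=> p0.
  have : `|Amat h ell n p q| <= \sum_(1 <= i < n.+1) `|coef h p i| * u i q.
    apply: le_trans (ler_norm_sum _ _ _) _; apply: ler_sum => i _.
    rewrite normrM ler_wpM2l// (le_trans (ler_normD _ _))// lerD2l normrM ger0_norm//.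
    by rewrite ler_wpM2l// ler_norm_sum.
  move=> le_A; rewrite -real_normK ?num_real//.
  apply: (@le_trans _ _ ((\sum_(1 <= i < n.+1) `|coef h p i| * u i q) ^+ 2)).
    by rewrite lerXn2r ?nnegrE// sumr_ge0// => i _; rewrite mulr_ge0.
  apply: le_trans (cauchy_schwarz_weighted _ _ _) _ => //.
  rewrite ler_wpM2r ?sumr_ge0// => [i _|]; first by rewrite mulr_ge0 ?sqr_ge0.
  by apply: le_trans (row p n p0); exact: ler_sum_subrange.
apply: (@le_trans _ _ (\sum_(1 <= p < n.+1) \sum_(1 <= q < n.+1)
   K2 * \sum_(1 <= i < n.+1) `|coef h p i| * u i q ^+ 2)).
  rewrite big_nat [leRHS]big_nat; apply: ler_sum => p /andP[p0 _].
  by apply: ler_sum => q _; exact: entry.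
under eq_bigr do rewrite -mulr_sumr exchange_big /=.
rewrite -mulr_sumr exchange_big /=.
rewrite (_ : 4 * K1 ^+ 2 * K2 ^+ 2 = K2 * (4 * K1 ^+ 2 * K2)); last by ring.
rewrite -mulrA ler_wpM2l// mulr_sumr; apply: ler_sum => i _.
under eq_bigr do rewrite -mulr_sumr.
rewrite -mulr_suml.
apply: (@le_trans _ _ (K1 * (4 * K1 * K2 * (1 + (ell i)%:R)))).
  by apply: ler_pM; rewrite ?col ?uS2 ?sumr_ge0// => q _; exact: sqr_ge0.
by rewrite le_eqVlt; apply/orP; left; apply/eqP; ring.
Qed.

(** Expanding the square shows that the trace misses exactly the pairs [j < i] with [j] before the
    window of [i]. There [e_p] is already present at [i - ell i], so [coef p i] carries the decay
    over the whole window; the row bound controls the sum over [j] and the column bound the sum over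
    [p]. *)
Lemma Amat_trace_bias : exists2 K : R, 0 <= K & forall n,
  `|\sum_(1 <= p < n.+1) Amat h ell n p p
    - \sum_(1 <= p < n.+1) (\sum_(1 <= i < n.+1) coef h p i) ^+ 2| <=
  K * \sum_(1 <= i < n.+1) `|decay h (i - ell i) i|.
Proof.
have [K1 K10 col] := coef_col_bound h_gt0 h_le1.
have [K2 K20 row] := coef_row_bound h_gt0 N0_gt0 h_le1 h_slow.
exists (2 * K1 * K2); first by rewrite !mulr_ge0.
(* The [minn] matters when [ell i = 0]: [i.+1 - ell i] then exceeds [i]. *)
move=> n; pose far i p := \sum_(0 <= j < minn i (i.+1 - ell i)) coef h p j.
have splitw i p : \sum_(0 <= j < i) coef h p j = far i p + wcoef h ell i p.
  rewrite /far /wcoef; have [le|lt] := leqP i (i.+1 - ell i).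
    by rewrite [X in _ + X]big_geq ?addr0.
  by rewrite -big_cat_nat//= ltnW.
have sqr_sum p m : (\sum_(1 <= i < m.+1) coef h p i) ^+ 2 =
    \sum_(1 <= i < m.+1) coef h p i * (coef h p i + 2 * \sum_(0 <= j < i) coef h p j).
  elim: m => [|m ih]; first by rewrite !big_geq// expr0n.
  rewrite (@big_nat_recr _ _ _ m.+1)//= [RHS](@big_nat_recr _ _ _ m.+1)//= sqrrD ih -addrA; congr (_ + _).
  rewrite (big_ltn (ltn0Sn m)) [coef h p 0]/= add0r -mulr_natl; ring.
have -> : \sum_(1 <= p < n.+1) Amat h ell n p p
    - \sum_(1 <= p < n.+1) (\sum_(1 <= i < n.+1) coef h p i) ^+ 2 =
    - \sum_(1 <= i < n.+1) \sum_(1 <= p < n.+1) 2 * (coef h p i * far i p).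
  rewrite [X in _ = - X]exchange_big /= -sumrB -sumrN; apply: eq_bigr => p _.
  rewrite sqr_sum -sumrB -sumrN; apply: eq_bigr => i _.
  rewrite splitw; ring.
rewrite normrN mulr_sumr; apply: le_trans (ler_norm_sum _ _ _) _.
apply: ler_sum => i _; rewrite -mulr_sumr normrM ger0_norm// -!mulrA ler_wpM2l//.
have term p : (0 < p)%N -> `|coef h p i * far i p| <=
    `|decay h (i - ell i) i| * (`|coef h p (i - ell i)| * K2).
  move=> p0; have far_le : `|far i p| <= K2.
    apply: le_trans (ler_norm_sum _ _ _) _; apply: le_trans (row p i p0).
    by apply: ler_sum_subrange => //; lia.
  have [pb|bp] := leqP p (i - ell i).
    rewrite (@coef_decay _ _ p (i - ell i) i); last by lia.
    by rewrite !normrM -mulrA ler_wpM2l// ler_wpM2l.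
  rewrite (_ : far i p = 0) ?mulr0 ?normr0 ?mulr_ge0//.
  by rewrite /far big_nat big1// => j jb; rewrite coef_lt//; lia.
apply: le_trans (ler_norm_sum _ _ _) _.
apply: (@le_trans _ _ (\sum_(1 <= p < n.+1)
    `|decay h (i - ell i) i| * (`|coef h p (i - ell i)| * K2))).
  by rewrite big_nat [leRHS]big_nat; apply: ler_sum => p /andP[p0 _]; exact: term.
rewrite -mulr_sumr -mulr_suml.
rewrite [leRHS](_ : _ = `|decay h (i - ell i) i| * (K1 * K2)); last by ring.
by rewrite ler_wpM2l// ler_wpM2r.
Qed.

End filter_estimates.

(** * Polynomially decaying steps *)

Section asymptotics.
Context {R : realType}.

Lemma near_natr_ge (K : R) : \forall n \near \oo, K <= n%:R.
Proof.
exists (Num.truncn K).+1 => // n /= Kn.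
by apply: le_trans (ltW (truncnS_gt K)) _; rewrite ler_nat.
Qed.

Lemma near_powR_ge (b K : R) : 0 < b -> \forall n \near \oo, K <= n%:R `^ b.
Proof.
move=> b0; have [N _ HN] := near_natr_ge (Num.max K 0 `^ b^-1).
exists N => // n /HN /= Kn; have m0 : 0 <= Num.max K 0 by rewrite le_max lexx orbT.
apply: (@le_trans _ _ (Num.max K 0)); first by rewrite le_max lexx.
rewrite [leLHS](_ : _ = (Num.max K 0 `^ b^-1) `^ b); last first.
  by rewrite -powRrM mulVf ?powRr1// gt_eqF.
by apply: (ge0_ler_powR (ltW b0)) => //; rewrite nnegrE ?powR_ge0.
Qed.

Lemma near_ln_ge (K : R) : \forall n \near \oo, K <= ln (n%:R : R).
Proof.
have [N _ HN] := near_natr_ge (expR K).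
exists N => // n /HN /= Kn.
rewrite -(expRK K) ler_ln// posrE ?expR_gt0//.
by apply: lt_le_trans Kn; exact: expR_gt0.
Qed.

Lemma near_powR_ln_le (a eps : R) : a < 1 -> 0 < eps ->
  \forall n \near \oo, n%:R `^ a * ln n%:R <= eps * n%:R :> R.
Proof.
(* Half of the spare exponent [1 - a] absorbs the logarithm, through [ln (n^dlt) <= n^dlt]; the
   other half beats the constant [(eps * dlt)^-1]. *)
move=> a1 eps0; pose dlt := (1 - a) / 2.
have d0 : 0 < dlt by rewrite divr_gt0 ?subr_gt0.
have [N _ HN] := near_powR_ge (eps * dlt)^-1 d0.
exists (maxn N 1) => // n /=; rewrite geq_max => /andP[/HN /= Kn n1].
have x0 : 0 < n%:R :> R by rewrite ltr0n.
have pd0 : 0 < n%:R `^ dlt :> R by exact: powR_gt0.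
have pa0 : 0 < n%:R `^ a :> R by exact: powR_gt0.
have lnle : ln (n%:R : R) <= n%:R `^ dlt / dlt.
  rewrite ler_pdivlMr// mulrC -ln_powR.
  have := le_ln1Dx (x := n%:R `^ dlt - 1) ltac:(lra).
  by rewrite addrC subrK; lra.
have nE : n%:R = n%:R `^ a * (n%:R `^ dlt * n%:R `^ dlt) :> R.
  rewrite -!powRD ?(negbT (gt_eqF x0)) ?implybT//.
  by rewrite (_ : a + _ = 1) ?powRr1 ?ltW// /dlt; lra.
rewrite [leRHS](_ : _ = n%:R `^ a * (eps * n%:R `^ dlt * n%:R `^ dlt)); last first.
  by rewrite {1}nE; ring.
rewrite ler_wpM2l ?(ltW pa0)//; apply: le_trans lnle _.
rewrite mulrC ler_wpM2r ?(ltW pd0)//.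
rewrite -ler_pdivrMl// -invfM//.
Qed.

Lemma sum_inv_le_ln n : (0 < n)%N ->
  \sum_(1 <= i < n.+1) i%:R^-1 <= 1 + ln n%:R :> R.
Proof.
elim: n => // -[|n] ih _; first by rewrite big_nat1 invr1 ln1 addr0.
rewrite big_nat_recr//=; apply: le_trans (lerD (ih isT) (lexx _)) _.
have x0 : 0 < n.+1%:R :> R by [].
have y0 : 0 < n.+2%:R :> R by [].
(* This gives [ln n.+2 - ln n.+1 >= 1 / n.+2]. *)
have := le_ln1Dx (x := - n.+2%:R^-1 : R).
rewrite (_ : 1 + - n.+2%:R^-1 = n.+1%:R * n.+2%:R^-1); last first.
  by rewrite -(natr1 n.+1); move: (n.+1%:R : R) x0 => x x0; field; rewrite gt_eqF//; lra.
rewrite lnM ?posrE ?invr_gt0// lnV ?posrE// => H.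
have : -1 < - n.+2%:R^-1 :> R by rewrite ltrN2 invf_lt1// ltr1n.
move/H; move: (ln n.+1%:R) (ln n.+2%:R) (n.+2%:R^-1 : R) => a b c; lra.
Qed.

End asymptotics.

(** * The steps [eta * i^(- alpha)] and their windows *)

Section steps.
Context {R : realType} (eta alpha C : R).
Hypotheses (eta0 : 0 < eta) (alpha0 : 0 < alpha) (alpha1 : alpha < 1) (C0 : 0 < C).
Local Notation h := (step eta alpha).
Local Notation ell := (ell C alpha).

Lemma step_gt0 i : (0 < i)%N -> 0 < h i.
Proof. by move=> i0; rewrite mulr_gt0// powR_gt0// ltr0n. Qed.

Lemma step_anti i j : (0 < i <= j)%N -> h j <= h i.
Proof.
move=> /andP[i0 ij]; rewrite ler_wpM2l ?(ltW eta0)// !powRN.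
rewrite lef_pV2 ?posrE ?powR_gt0 ?ltr0n ?(leq_trans i0)//.
by apply: (ge0_ler_powR (ltW alpha0)); rewrite ?nnegrE ?ler_nat.
Qed.

Lemma near_step_le1 : \forall i \near \oo, h i <= 1.
Proof.
have [N _ HN] := near_powR_ge eta alpha0.
exists (maxn N 1) => // i /=; rewrite geq_max => /andP[/HN /= le_eta i1].
by rewrite /step powRN ler_pdivrMr ?mul1r// powR_gt0// ltr0n.
Qed.

(** [1 / h i] is [i^alpha / eta], and [(1 + 1/i)^alpha <= 1 + 1/i] bounds its increment by
    [i^(alpha - 1) / eta], which tends to 0. *)
Lemma near_step_slow : \forall i \near \oo, (h i.+1)^-1 - (h i)^-1 <= 2^-1.
Proof.
have a1 : 0 < 1 - alpha by rewrite subr_gt0.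
have [N _ HN] := near_powR_ge (2 / eta) a1.
exists (maxn N 1) => // i /=; rewrite geq_max => /andP[/HN /= big_i i1].
have x0 : 0 < i%:R :> R by rewrite ltr0n.
have pa0 : 0 < i%:R `^ alpha by exact: powR_gt0.
have pb0 : 0 < i%:R `^ (1 - alpha) by exact: powR_gt0.
have xE : i%:R = i%:R `^ alpha * i%:R `^ (1 - alpha).
  rewrite -powRD ?(negbT (gt_eqF x0)) ?implybT//.
  by rewrite (_ : alpha + _ = 1) ?powRr1 ?ltW//; lra.
have succ : i.+1%:R `^ alpha <= i%:R `^ alpha + (i%:R `^ (1 - alpha))^-1.
  have -> : i.+1%:R = i%:R * (1 + i%:R^-1) :> R.
    by rewrite -natr1 mulrDr mulr1 divff ?gt_eqF.
  rewrite powRM ?addr_ge0 ?invr_ge0//.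
  have : (1 + i%:R^-1) `^ alpha <= 1 + i%:R^-1 :> R.
    by apply: ler1_powR; rewrite ?lerDl ?invr_ge0// ltW.
  move/(ler_wpM2l (ltW pa0)) => /le_trans; apply.
  rewrite mulrDr mulr1 lerD2l {2}xE invfM mulrA divff ?mul1r//.
  by rewrite gt_eqF.
rewrite /step !invfM -mulrBr !powRN !invrK ler_pdivrMl//.
apply: (@le_trans _ _ (i%:R `^ (1 - alpha))^-1); first by lra.
rewrite -[leRHS]invrK lef_pV2 ?posrE ?invr_gt0 ?divr_gt0//.
by rewrite invfM invrK mulrC.
Qed.

Lemma ell_le i : (0 < i)%N -> (ell i)%:R <= C * i%:R `^ alpha * ln (i%:R : R).
Proof.
move=> i0; rewrite truncn_le mulr_ge0 ?mulr_ge0 ?powR_ge0 ?(ltW C0)//.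
by rewrite ln_ge0// ler1n.
Qed.

Lemma ell_gt i : C * i%:R `^ alpha * ln (i%:R : R) < (ell i)%:R + 1.
Proof. by rewrite natr1 truncnS_gt. Qed.

Lemma ell_mono i j : (0 < i <= j)%N -> (ell i <= ell j)%N.
Proof.
move=> /andP[i0 ij]; have j0 : (0 < j)%N by exact: leq_trans ij.
rewrite -ltnS -(ltr_nat R) -natr1.
apply: le_lt_trans (ell_le i0) _; apply: le_lt_trans (ell_gt j).
rewrite -!mulrA ler_wpM2l ?(ltW C0)//; apply: ler_pM.
- exact: powR_ge0.
- by rewrite ln_ge0// ler1n.
- by apply: (ge0_ler_powR (ltW alpha0)); rewrite ?nnegrE ?ler_nat.
- by rewrite ler_ln ?posrE ?ltr0n// ler_nat.
Qed.

Hypothesis etaC : 1 < eta * C.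

(* [prod (1 - eta_m) <= exp (- sum eta_m) <= exp (- ell_i eta_i)] over the window, and
   [ell_i eta_i >= eta C log i - eta_i] with [eta C > 1]. *)
Lemma near_decay_window_le :
  \forall i \near \oo, `|decay h (i - ell i) i| <= expR 1 * i%:R^-1.
Proof.
have [N1 _ HN1] := near_step_le1.
have c0 : 0 < (2 * C)^-1 by rewrite invr_gt0 mulr_gt0.
have [N2 _ HN2] := near_powR_ln_le alpha1 c0.
exists (maxn (2 * N1 + 2) N2) => // i /=; rewrite geq_max => /andP[iN1 /HN2 /= small].
have i0 : (0 < i)%N by lia.
have x0 : 0 < i%:R :> R by rewrite ltr0n.
(* A window of at most half of [i] stays beyond [N1], where every factor [1 - h m] is
   nonnegative. *)
have elli : (2 * ell i <= i)%N.
  rewrite -(ler_nat R) natrM; have := ell_le i0.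
  have : C * (i%:R `^ alpha * ln i%:R) <= C * ((2 * C)^-1 * i%:R).
    by rewrite ler_wpM2l// ltW.
  have -> : C * ((2 * C)^-1 * i%:R) = i%:R / 2 by field; rewrite gt_eqF.
  rewrite mulrA; lra.
have hi0 := step_gt0 i0.
have d0 : 0 <= decay h (i - ell i) i.
  by apply: (@decay_ge0 _ h N1) => [m Nm|]; [exact: HN1|clear - iN1 elli; lia].
have dle : decay h (i - ell i) i <= expR (- h i) ^+ ell i.
  rewrite [leRHS](_ : _ = \prod_((i - ell i).+1 <= m < i.+1) expR (- h i)); last first.
    by rewrite prodr_const_nat subSS subKn//; clear - elli; lia.
  rewrite /decay big_nat [leRHS]big_nat.
  apply: ler_prod => m im.
  have him : h i <= h m by apply: step_anti; clear - im; lia.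
  have hm1 : h m <= 1 by apply: HN1 => /=; clear - im iN1 elli; lia.
  rewrite subr_ge0 hm1 /=.
  apply: (@le_trans _ _ (1 - h i)); first by lra.
  exact: expR_ge1Dx.
rewrite ger0_norm//; apply: le_trans dle _.
rewrite -expRM_natl -[in leRHS](lnK (x := i%:R : R)) ?posrE// -expRN -expRD ler_expR.
have ell_h : C * i%:R `^ alpha * ln (i%:R : R) * h i <= ((ell i)%:R + 1) * h i.
  by rewrite ler_wpM2r ?(ltW hi0)// ltW// ell_gt.
have hE : C * i%:R `^ alpha * ln (i%:R : R) * h i = eta * C * ln i%:R.
  by rewrite /step powRN; field; rewrite gt_eqF// powR_gt0.
(* Rounding [ell i] down costs a factor [expR (h i)]; this is the [expR 1] of the statement. *)
have h1 : h i <= 1 by apply: HN1 => /=; clear - iN1; lia.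
have ln0 : 0 <= ln (i%:R : R) by rewrite ln_ge0// ler1n.
have := ler_wpM2r ln0 (ltW etaC).
rewrite mulrN; lra.
Qed.

Lemma sum_decay_window_le : exists2 K : R, 0 <= K & \forall n \near \oo,
  \sum_(1 <= i < n.+1) `|decay h (i - ell i) i| <= K * ln n%:R.
Proof.
have [N _ HN] := near_decay_window_le.
pose K0 := \sum_(0 <= i < N) `|decay h (i - ell i) i|.
have K00 : 0 <= K0 by apply: sumr_ge0.
have e0 := expR_gt0 (1 : R).
(* As [ln n >= 1] eventually, the early windows [K0] and the 1 of the harmonic bound are both
   absorbed into [ln n]. *)
exists (K0 + 2 * expR 1); first by rewrite addr_ge0// mulr_ge0// ltW.
have [N' _ HN'] := near_ln_ge (1 : R).
exists (maxn N' 1) => // n /=; rewrite geq_max => /andP[/HN' /= ln1 n1].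
have term i : (0 < i)%N -> `|decay h (i - ell i) i| <=
    (if (i < N)%N then `|decay h (i - ell i) i| else 0) + expR 1 * i%:R^-1.
  move=> i0; case: ltnP => [_|/HN /= iN]; last by rewrite add0r.
  by rewrite lerDl mulr_ge0 ?invr_ge0// ltW.
apply: (@le_trans _ _ (\sum_(1 <= i < n.+1)
   ((if (i < N)%N then `|decay h (i - ell i) i| else 0) + expR 1 * i%:R^-1))).
  by rewrite big_nat [leRHS]big_nat; apply: ler_sum => i /andP[i0 _]; exact: term.
rewrite big_split /= -mulr_sumr.
have s1 : \sum_(1 <= i < n.+1) (if (i < N)%N then `|decay h (i - ell i) i| else 0) <= K0.
  apply: (@le_trans _ _ (\sum_(0 <= i < maxn n.+1 N)
     (if (i < N)%N then `|decay h (i - ell i) i| else 0))).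
    by apply: ler_sum_subrange => [i||]; [case: ifP| |lia].
  rewrite (@big_cat_nat _ _ _ N)//= ?leq_maxr// [X in _ + X]big_nat [X in _ + X]big1.
    by rewrite addr0 big_nat [leRHS]big_nat; apply: ler_sum => i /= ->.
  by move=> i /andP[Ni _]; rewrite ltnNge Ni.
have := ler_wpM2l (ltW e0) (sum_inv_le_ln n1).
move: (expR 1) e0 => E e0 s2.
have : E + E * ln n%:R <= 2 * E * ln n%:R by nra.
have : K0 <= K0 * ln n%:R by rewrite ler_peMr.
lra.
Qed.

Lemma sum_ell_le n : (0 < n)%N -> 1 <= ln (n%:R : R) ->
  \sum_(1 <= i < n.+1) (1 + (ell i)%:R) <= (1 + C) * (n%:R * n%:R `^ alpha * ln (n%:R : R)).
Proof.
move=> n0 ln1; have n1 : 1 <= n%:R :> R by rewrite ler1n.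
have pn1 : 1 <= n%:R `^ alpha.
  by rewrite -[leLHS](powRr0 (n%:R : R)) ler_powR// ltW.
apply: (@le_trans _ _ (\sum_(1 <= i < n.+1) (1 + C) * (n%:R `^ alpha * ln n%:R))).
  rewrite big_nat [leRHS]big_nat; apply: ler_sum => i /andP[i0]; rewrite ltnS => ilen.
  have := ell_mono (ltac:(lia) : (0 < i <= n)%N); rewrite -(ler_nat R).
  have := ell_le n0.
  have : 1 <= n%:R `^ alpha * ln n%:R by rewrite -[leLHS]mulr1 ler_pM.
  rewrite -mulrA; lra.
by rewrite sumr_const_nat subSS subn0 -[leLHS]mulr_natl; lra.
Qed.

End steps.

(** Between [lo], near [n / 2], and [n], steps and window lengths change only by bounded factors,
    and [k], near [n / 8], leaves room for the chosen [p] and their windows. *)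
Lemma half_and_eighth n N : (2 * N + 16 <= n)%N -> exists lo k : nat,
  [/\ (N < lo)%N, (lo <= n)%N, (n <= 4 * lo)%N, (lo + 4 * k <= n)%N & (n <= 16 * k)%N].
Proof. by move=> Nn; exists (n %/ 2)%N, (n %/ 8)%N; split; lia. Qed.

Section offdiag.
Context {R : realType} (eta alpha C : R).
Hypotheses (eta0 : 0 < eta) (alpha0 : 0 < alpha) (alpha1 : alpha < 1) (C0 : 0 < C).
Hypothesis etaC : 1 < eta * C.
Local Notation h := (step eta alpha).
Local Notation ell := (ell C alpha).

Lemma near_Amat_offdiag_ge : exists2 c : R, 0 < c & \forall n \near \oo,
  c * (n%:R * n%:R `^ alpha * ln (n%:R : R)) <=
  \sum_(1 <= p < n.+1) \sum_(1 <= q < n.+1 | (q < p)%N)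
    (Amat h ell n p q + Amat h ell n q p) ^+ 2.
Proof.
(* The factors bound [k / n], [l / (n^alpha log n)] and the square of one entry; [128^-1] is half of
   [8^-1] squared. *)
exists (16^-1 * (C / 16) * (128^-1) ^+ 2).
  by rewrite !mulr_gt0// ?divr_gt0// invr_gt0.
have [N1 _ HN1] := near_step_le1 eta alpha0.
have eps0 : 0 < (16 * C)^-1 by rewrite invr_gt0 mulr_gt0.
have [N2 _ HN2] := near_powR_ln_le alpha1 eps0.
have [N3 _ HN3] := near_ln_ge (8 : R).
have [N4 _ HN4] := near_powR_ge (8 / C) alpha0.
exists (maxn (maxn (2 * N1 + 16) N2) (maxn N3 N4)) => // n /=.
rewrite !geq_max => /andP[/andP[nN1 nN2] /andP[nN3 nN4]].
have n16 : (16 <= n)%N by exact: leq_trans (leq_addl _ _) nN1.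
have [lo [k [N1lo lo_n n_lo lok_n n_k]]] := half_and_eighth nN1.
have small := HN2 n nN2; have lnx8 := HN3 n nN3; have powx8 := HN4 n nN4.
rewrite /= in small lnx8 powx8.
set x : R := n%:R in small lnx8 powx8 *.
set y : R := lo%:R.
have x16 : 16 <= x by rewrite ler_nat.
have yx : y <= x by rewrite ler_nat.
have xy : x <= 4 * y by rewrite /x /y -natrM ler_nat.
have xk : x <= 16 * k%:R by rewrite /x -natrM ler_nat.
have x0 : 0 < x by lra.
have y0 : 0 < y by lra.
have px0 : 0 < x `^ alpha by exact: powR_gt0.
have py0 : 0 < y `^ alpha by exact: powR_gt0.
have pyx : y `^ alpha <= x `^ alpha.
  by apply: (ge0_ler_powR (ltW alpha0)) => //; rewrite nnegrE ltW.
have pxy : x `^ alpha <= 4 * y `^ alpha.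
  apply: (@le_trans _ _ ((4 * y) `^ alpha)).
    by apply: (ge0_ler_powR (ltW alpha0)); rewrite ?nnegrE// ltW// mulr_gt0.
  rewrite powRM ?(ltW y0)// ler_wpM2r ?(ltW py0)//.
  by apply: ler1_powR; rewrite ?ltW// ltr1n.
have lnyx : ln y <= ln x by rewrite ler_ln ?posrE.
have lnxy : ln x <= 2 * ln y.
  have -> : 2 * ln y = ln (y * y) by rewrite lnM ?posrE//; lra.
  by rewrite ler_ln ?posrE ?mulr_gt0//; nra.
have Cpow : C * (x `^ alpha * ln x) <= x / 16.
  have := ler_wpM2l (ltW C0) small.
  have -> : C * ((16 * C)^-1 * x) = x / 16 by field; rewrite gt_eqF.
  by [].
have invC : eta^-1 <= C by rewrite -[leLHS]mul1r ler_pdivrMr// mulrC ltW.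
(* [theta] is the largest step on the range, and [g] the longest delay with [g * theta <= 1 / 2].
   [L] is the smallest window there, of which [l] will be what is left after [2g + 1]. *)
pose theta := h lo; pose g := Num.truncn (2 * theta)^-1; pose L := ell lo.
have lo0 : (0 < lo)%N by exact: leq_ltn_trans N1lo.
have n0 : (0 < n)%N by exact: leq_trans n16.
have th0 : 0 < theta by exact: step_gt0.
have thE : theta^-1 = eta^-1 * y `^ alpha by rewrite /theta /step invfM powRN invrK.
have lamE : h n = eta / x `^ alpha by rewrite /step powRN.
have gle : g%:R <= (2 * theta)^-1 by rewrite truncn_le invr_ge0 mulr_ge0// ltW.
have ggt : (2 * theta)^-1 < g.+1%:R by exact: truncnS_gt.
have g2 : 2 * g%:R <= C * y `^ alpha.
  have : 2 * g%:R <= theta^-1 by move: gle; rewrite invfM; lra.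
  rewrite thE; have := ler_wpM2r (ltW py0) invC; lra.
have Lle : L%:R <= C * y `^ alpha * ln y := ell_le alpha C0 lo0.
have Lgt : C * y `^ alpha * ln y < L%:R + 1 := ell_gt alpha C lo.
have Lk : (L <= k)%N.
  rewrite -(ler_nat R); apply: le_trans Lle _.
  apply: (@le_trans _ _ (x / 16)); last by lra.
  apply: le_trans Cpow; rewrite -mulrA ler_wpM2l ?(ltW C0)//.
  by apply: ler_pM => //; [exact: ltW|lra].
have Z2 : 2 <= C * y `^ alpha.
  have : 8 <= C * x `^ alpha by rewrite -ler_pdivrMl// mulrC.
  have := ler_wpM2l (ltW C0) pxy; lra.
have lny4 : 4 <= ln y by lra.
(* With [Z = C * y^alpha], [2g <= Z], [Z >= 2] and [ln y >= 4], removing [2g + 1] from the window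
   leaves at least [Z * ln y / 2]; the thresholds 8 on [ln x] and [8 / C] on [x^alpha] were set for
   this. *)
have Lg : C * y `^ alpha * ln y / 2 + 2 * g%:R + 1 <= L%:R.
  by move: (C * y `^ alpha) g2 Lgt Z2 => Z g2 Lgt Z2; nra.
have gL : (2 * g + 1 <= L)%N.
  rewrite -(ler_nat R) natrD natrM.
  have : 0 <= C * y `^ alpha * ln y / 2 by rewrite !mulr_ge0// ?(ltW C0) ?(ltW py0)//; lra.
  by lra.
have [l Ll] : exists l, L = (2 * g + 1 + l)%N by exists (L - (2 * g + 1))%N; rewrite subnKC.
have lE : l%:R = L%:R - 2 * g%:R - 1 :> R by rewrite Ll 2!natrD natrM; lra.
have [gk lk] : (g <= k)%N /\ (lo + 2 * k + g + l <= n)%N.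
  by move: (L) Ll Lk => L' -> Lk; clear - Lk lok_n; lia.
have hle1 i : (N1.+1 <= i)%N -> h i <= 1 by move=> /ltnW /HN1.
apply: le_trans (@Amat_offdiag_ge _ h ell N1.+1 (step_gt0 alpha eta0) isT hle1 lo n k g l
  (h n) theta _ _ _ _ _ _ _ _); last first.
- move=> i /andP[loi ilen].
  have : (L <= ell i)%N by apply: ell_mono => //; rewrite lo0.
  by rewrite Ll addn1 addSn; apply: leq_trans; rewrite ltnS.
- exact: lk.
- exact: gk.
- move=> m /andP[lom mn]; rewrite !step_anti// ?lo0 ?lom//.
  by rewrite (leq_trans lo0 lom) mn.
- by rewrite ltW// step_gt0.
- by rewrite -ler_pdivlMr// -invfM.
- by apply: hle1.
- exact: N1lo.
(* [g + 1] exceeds [1 / (2 * theta)], and [h n / theta = (y / x)^alpha] is at least [1 / 4]. *)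
have B8 : 8^-1 <= g.+1%:R * h n.
  apply: (@le_trans _ _ ((2 * theta)^-1 * h n)); last first.
    by rewrite ler_wpM2r ?(ltW ggt)// ltW// step_gt0.
  rewrite invfM thE lamE.
  have -> : 2^-1 * (eta^-1 * y `^ alpha) * (eta / x `^ alpha) =
     2^-1 * (y `^ alpha / x `^ alpha) by field; rewrite !gt_eqF.
  have : 4^-1 <= y `^ alpha / x `^ alpha by rewrite ler_pdivlMr//; lra.
  by lra.
have B128 : 128^-1 <= 2^-1 * (g.+1%:R * h n) ^+ 2.
  by move: (g.+1%:R * h n) B8 => G B8; nra.
have l16 : C / 16 * (x `^ alpha * ln x) <= l%:R.
  rewrite lE; apply: (@le_trans _ _ (C * y `^ alpha * ln y / 2)); last by lra.
  have : x `^ alpha * ln x <= 4 * y `^ alpha * (2 * ln y).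
    by apply: ler_pM; rewrite ?(ltW px0)//; lra.
  move/(ler_wpM2l (ltW C0)); lra.
rewrite natrM.
have sq : (128^-1) ^+ 2 <= (2^-1 * (g.+1%:R * h n) ^+ 2) ^+ 2.
  by rewrite lerXn2r ?nnegrE// mulr_ge0// sqr_ge0.
have kx : x / 16 <= k%:R by lra.
have l0 : 0 <= C / 16 * (x `^ alpha * ln x).
  by rewrite !mulr_ge0// ?(ltW C0) ?(ltW px0)//; lra.
rewrite [leLHS](_ : _ = x / 16 * (C / 16 * (x `^ alpha * ln x)) * 128^-1 ^+ 2); last by ring.
apply: ler_pM => //; first by rewrite mulr_ge0//; lra.
by apply: ler_pM => //; lra.
Qed.

End offdiag.

(** * The mean square error *)

Lemma sigma_hat_quadratic (T : Type) (R : realType) (eta alpha C : R)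
    (e : nat -> T -> R) n w :
  sigma_hat eta alpha C e n w = n%:R^-1 * \sum_(1 <= p < n.+1) \sum_(1 <= q < n.+1)
    Amat (step eta alpha) (ell C alpha) n p q * (e p w * e q w).
Proof.
set h := step eta alpha; congr (_ * _).
have XE i : (i <= n)%N -> Xseq eta alpha e i w = \sum_(1 <= p < n.+1) coef h p i * e p w.
  by move=> lin; apply: Xseq_coef.
have WE i : (i <= n)%N -> Wsum eta alpha C e i w =
    \sum_(1 <= q < n.+1) wcoef h (ell C alpha) i q * e q w.
  move=> lin; under [RHS]eq_bigr do rewrite mulr_suml.
  rewrite exchange_big /= /Wsum; apply: eq_big_nat => j /andP[_ ji].
  by apply: XE; exact: leq_trans (ltnW ji) lin.
transitivity (\sum_(1 <= i < n.+1) \sum_(1 <= p < n.+1) \sum_(1 <= q < n.+1)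
    coef h p i * (coef h q i + 2 * wcoef h (ell C alpha) i q) * (e p w * e q w)).
  apply: eq_big_nat => i /andP[_ lin].
  rewrite (_ : _ + _ = Xseq eta alpha e i w *
    (Xseq eta alpha e i w + 2 * Wsum eta alpha C e i w)); last by ring.
  rewrite ltnS in lin; rewrite XE// WE// mulr_suml; apply: eq_bigr => p _.
  rewrite [X in _ + X]mulr_sumr -big_split /= mulr_sumr; apply: eq_bigr => q _.
  by ring.
rewrite exchange_big /=; apply: eq_bigr => p _.
rewrite exchange_big /=; apply: eq_bigr => q _.
by rewrite /Amat mulr_suml.
Qed.

Section mean_square_error.
Context {R : realType} {d : measure_display} {T : measurableType d}.
Variables (P : probability T R) (eta alpha C : R) (e : nat -> {RV P >-> R}) (M : nat -> R).
Local Notation D := [set i : nat | (0 < i)%N].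
Hypothesis ind : mutually_independent P D e.
Hypothesis eM : forall i k, i \in D -> (k <= 4)%N -> has_mean P (fun w => e i w ^+ k) (M k).
Hypothesis M1 : M 1%N = 0.
Local Notation h := (step eta alpha).

Let iota_D n : {subset index_iota 1 n.+1 <= D}.
Proof. by move=> i; rewrite mem_index_iota => /andP[i0 _]; rewrite inE. Qed.

(** The square of the sum of the [X_i] is the rank-one form [S p * S q], so its mean is [M 2] times
    the trace. *)
Lemma sigma_nE n : sigma_n P eta alpha (fun i => e i) n =
  n%:R^-1 * (M 2%N * \sum_(1 <= p < n.+1) (\sum_(1 <= i < n.+1) coef h p i) ^+ 2).
Proof.
pose S p := \sum_(1 <= i < n.+1) coef h p i.
have H := has_mean_quadratic ind eM M1 (fun p q => S p * S q) (iota_uniq _ _) (@iota_D n).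
rewrite /sigma_n (expectation_has_mean (m := M 2%N * \sum_(1 <= p < n.+1) S p ^+ 2))//.
apply: (eq_has_mean _ _ H) => // w.
have -> : \sum_(1 <= i < n.+1) Xseq eta alpha (fun i => e i) i w =
    \sum_(1 <= p < n.+1) S p * e p w.
  under [RHS]eq_bigr do rewrite mulr_suml.
  rewrite exchange_big /=; apply: eq_big_nat => i /andP[_ lin].
  exact: Xseq_coef.
rewrite expr2 mulr_suml; apply: eq_bigr => p _.
by rewrite mulr_sumr; apply: eq_bigr => q _; ring.
Qed.

Lemma has_mean_sigma_hat_mse n :
  has_mean P (fun w => (sigma_hat eta alpha C (fun i => e i) n w
                        - sigma_n P eta alpha (fun i => e i) n) ^+ 2)
    (n%:R^-1 ^+ 2 * quadratic_mse M (index_iota 1 n.+1) (Amat h (ell C alpha) n)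
       (M 2%N * \sum_(1 <= p < n.+1) (\sum_(1 <= i < n.+1) coef h p i) ^+ 2)).
Proof.
have H := has_mean_quadratic_mse ind eM M1 (Amat h (ell C alpha) n) (iota_uniq _ _) (@iota_D n)
  (M 2%N * \sum_(1 <= p < n.+1) (\sum_(1 <= i < n.+1) coef h p i) ^+ 2).
apply: (eq_has_mean _ _ (has_meanZ (n%:R^-1 ^+ 2) H)) => // w.
by rewrite sigma_hat_quadratic sigma_nE -mulrBr exprMn.
Qed.

End mean_square_error.

Theorem theoremC1 (R : realType) (d : measure_display) (T : measurableType d)
    (P : probability T R) (eta alpha sigma_e C : R)
    (e : nat -> {RV P >-> R}) :
  0 < eta -> 2^-1 < alpha -> alpha < 1 -> 0 < sigma_e -> 1 < eta * C ->
  mutually_independent P [set i | (0 < i)%N] e ->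
  (forall i, (0 < i)%N -> forall A : set R, measurable A ->
     distribution P (e i) A = normal_prob 0 sigma_e A) ->
  exists c C' : R, 0 < c /\ c <= C' /\
    exists N : nat, forall n : nat, (N <= n)%N ->
      let b := n%:R `^ (alpha - 1) * ln (n%:R) in
      let E := 'E_P[fun w => ((sigma_hat eta alpha C (fun i => e i) n w
                               - sigma_n P eta alpha (fun i => e i) n) ^+ 2)%R]%E in
      ((c * b)%:E <= E)%E /\ (E <= (C' * b)%:E)%E.
Proof.
move=> eta0 alpha_gt alpha1 s0 etaC ind law.
have alpha0 : 0 < alpha by apply: lt_trans alpha_gt; rewrite invr_gt0.
have C0 : 0 < C by rewrite -(pmulr_rgt0 _ eta0); apply: lt_trans etaC.
have [M [M1 v0 kurt HM]] := gaussian_moments s0.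
have eM i k : i \in [set i : nat | (0 < i)%N] -> (k <= 4)%N ->
    has_mean P (fun w => e i w ^+ k) (M k).
  by rewrite inE => i0; apply: HM; exact: law.
pose h := step eta alpha.
have [N1 _ HN1] := near_step_le1 eta alpha0.
have [N2 _ HN2] := near_step_slow eta0 alpha1.
pose N0 := maxn (maxn N1 N2) 1.
have hle1 i : (N0 <= i)%N -> h i <= 1.
  by rewrite !geq_max => /andP[/andP[/HN1]].
have hslow i : (N0 <= i)%N -> (h i.+1)^-1 - (h i)^-1 <= 2^-1.
  by rewrite !geq_max => /andP[/andP[_ /HN2]].
have N00 : (0 < N0)%N by rewrite leq_maxr.
have [K1 K10 frob] := Amat_frobenius_le (ell C alpha) (step_gt0 alpha eta0) N00 hle1 hslow.
have [K2 K20 bias] := Amat_trace_bias (ell C alpha) (step_gt0 alpha eta0) N00 hle1 hslow.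
have [c c0 [N3 _ low]] := near_Amat_offdiag_ge eta0 alpha0 alpha1 C0 etaC.
have [K3 K30 [N4 _ dec]] := sum_decay_window_le eta0 alpha0 alpha1 C0 etaC.
have [N5 _ lnbig] := near_ln_ge (1 : R).
pose v := M 2%N; pose cl := v ^+ 2 / 2 * c.
pose cu := (v * (K2 * K3)) ^+ 2 + (2 * v ^+ 2 + M 4%N) * (K1 * (1 + C)).
have v2 : 0 < v ^+ 2 by rewrite exprn_gt0.
have cl0 : 0 < cl by rewrite mulr_gt0// divr_gt0.
have w0 : 0 <= 2 * v ^+ 2 + M 4%N.
  by have : v ^+ 2 <= M 4%N := kurt; lra.
have cu0 : 0 <= cu.
  rewrite /cu addr_ge0 ?sqr_ge0// (mulr_ge0 w0)// mulr_ge0//.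
  by rewrite addr_ge0// ltW.
(* Adding [cl] to the upper constant makes the required order of the constants immediate. *)
exists cl, (cl + cu); split=> //; split; first by rewrite lerDl.
exists (maxn (maxn N3 N4) (maxn N5 1)) => n.
rewrite !geq_max => /andP[/andP[/low /= lown /dec /= decn] /andP[/lnbig /= ln1 n0]].
set b := n%:R `^ (alpha - 1) * ln n%:R.
rewrite (expectation_has_mean (has_mean_sigma_hat_mse eta alpha C ind eM M1 n)).
set S := M 2%N * _; set mse := quadratic_mse _ _ _ _; rewrite !lee_fin.
have x0 : 0 < n%:R :> R by rewrite ltr0n.
pose L : R := n%:R * n%:R `^ alpha * ln n%:R.
have bL : b = n%:R^-1 ^+ 2 * L.
  rewrite /b /L powRD ?(negbT (gt_eqF x0)) ?implybT// powRN powRr1 ?ltW//.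
  by field; rewrite gt_eqF.
have pn1 : 1 <= n%:R `^ alpha :> R.
  by rewrite -[leLHS](powRr0 (n%:R : R)) ler_powR ?ler1n// ltW.
have L0 : 0 <= L by rewrite !mulr_ge0 ?powR_ge0//; lra.
have i2 : 0 <= n%:R^-1 ^+ 2 :> R by exact: sqr_ge0.
have mse_ge : cl * L <= mse.
  apply: le_trans (quadratic_mse_ge (Amat h (ell C alpha) n) (iota_uniq _ _) kurt S).
  by rewrite /cl -[leLHS]mulrA ler_wpM2l// divr_ge0// ltW.
have mse_le : mse <= cu * L.
  apply: le_trans (quadratic_mse_le (Amat h (ell C alpha) n) (iota_uniq _ _) kurt S) _.
  rewrite /cu [leRHS]mulrDl; apply: lerD; last first.
    rewrite -[leRHS]mulrA -[X in _ <= _ * X]mulrA ler_wpM2l//.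
    apply: le_trans (frob n) _; rewrite ler_wpM2l//.
    exact: (sum_ell_le eta0).
  rewrite /S -mulrBr [leLHS]exprMn.
  rewrite [leRHS](_ : _ = v ^+ 2 * ((K2 * K3) ^+ 2 * L)); last by ring.
  rewrite ler_wpM2l ?(ltW v2)// -real_normK ?num_real//.
  apply: (@le_trans _ _ ((K2 * (K3 * ln n%:R)) ^+ 2)).
    rewrite lerXn2r ?nnegrE ?mulr_ge0//; first by lra.
    by apply: le_trans (bias n) _; rewrite ler_wpM2l.
  (* The squared bias is negligible against [L], because [ln n <= n] and [n^alpha >= 1]. *)
  rewrite [leLHS](_ : _ = (K2 * K3) ^+ 2 * (ln n%:R * ln n%:R)); last by ring.
  rewrite ler_wpM2l ?sqr_ge0// /L ler_wpM2r//; first by lra.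
  have := le_ln1Dx (x := n%:R - 1 : R) ltac:(lra).
  rewrite addrC subrK => lnn; apply: (@le_trans _ _ (n%:R * 1)); first by lra.
  by rewrite ler_wpM2l// ltW.
split; rewrite bL mulrCA ler_wpM2l//.
by apply: le_trans mse_le _; rewrite ler_wpM2r// lerDr ltW.
Qed.
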